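(* Let $1/2\le\sigma\le 1$ and suppose the adjacent time-step ratios satisfy $0<\gamma_{n+1}\le\gamma_{**}(\sigma)$ for $n=1,\dots,M-1$. Let $(\phi^n,r^n)$ be generated by the time-stepping scheme: for $n=1,\dots,M-1$, $$F_2^{n+\sigma}\phi=\Delta\mu^{n+\sigma},$$ $$\mu^{n+\sigma}=(\Delta+\beta)^2\phi^{n+\sigma}+S\phi^{n+\sigma}+\frac{r^{n+1}}{\sqrt{E_1(\phi^n)+C_0}}F'(\phi^{*,n+\sigma}),$$ $$\frac{r^{n+1}-r^n}{\tau_{n+1}}=\frac{1}{2\sqrt{E_1(\phi^n)+C_0}}\int_\Omega F'(\phi^{*,n+\sigma})\frac{\phi^{n+1}-\phi^n}{\tau_{n+1}}\,d\mathbf{x},$$ with periodic boundary conditions. Then for $n=1,\dots,M-1$, $$\widetilde E^{n+1}-\widetilde E^{n}\le 0,$$ where $$\widetilde E^{n}:=\overline E(\phi^n,r^n)+\frac{(2\sigma-1)\gamma_{n+1}^{3/2}}{2+2\gamma_{n+1}}\,\frac{\|\nabla^{-1}(\phi^n-\phi^{n-1})\|^2}{\tau_n}.$$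
   Context: Setting: $\Omega\subset\mathbb{R}^d$ ($d=2$ or $3$) is a rectangular box with periodic boundary conditions; $(\cdot,\cdot)$ and $\|\cdot\|$ are the $L^2(\Omega)$ inner product and norm. Constants: $\beta>0$, $0<\varepsilon<\beta^2$, $S\ge 0$. The scheme approximates the phase field crystal equation $\phi_t=\Delta\mu$, $\mu=(\Delta+\beta)^2\phi+\phi^3-\varepsilon\phi$, where $(\Delta+\beta)^2\phi=\Delta^2\phi+2\beta\Delta\phi+\beta^2\phi$. Nonlinearity: $F(\phi)=\frac14\phi^4-\frac{S+\varepsilon}{2}\phi^2$ and $E_1(\phi)=\int_\Omega F(\phi)\,d\mathbf{x}$. The constant $C_0>0$ is large enough that $\frac{C_0}{2}\le E_1(\phi)+C_0\le 2C_0$ (in particular $E_1(\phi)+C_0>0$) at all functions $\phi$ at which the expression is evaluated. Also $\overline E(\phi,r):=\frac12\|(\Delta+\beta)\phi\|^2+\frac S2\|\phi\|^2+r^2$. Temporal mesh: $0=t_0<t_1<\dots<t_M=T$, $\tau_n:=t_n-t_{n-1}$ for $1\le n\le M$, and $\gamma_{n+1}:=\tau_{n+1}/\tau_n$ for $1\le n\le M-1$. Since $\gamma_{M+1}$ appears in $\widetilde E^M$ but is not determined by the mesh, it denotes an arbitrary fixed number in $(0,\gamma_{**}(\sigma)]$ (for $\sigma=1/2$: in $(0,\infty)$). Discrete operators: $\phi^{n+\sigma}:=\sigma\phi^{n+1}+(1-\sigma)\phi^n$, $\ \phi^{*,n+\sigma}:=\phi^n+\sigma\gamma_{n+1}(\phi^n-\phi^{n-1})$,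 and $$F_2^{n+\sigma}\phi:=\frac{1}{\tau_{n+1}}\Big[\frac{1+2\sigma\gamma_{n+1}}{1+\gamma_{n+1}}\phi^{n+1}-\big(1+(2\sigma-1)\gamma_{n+1}\big)\phi^n+\frac{(2\sigma-1)\gamma_{n+1}^2}{1+\gamma_{n+1}}\phi^{n-1}\Big].$$ Threshold: $G(s,z):=\frac{2+4\sigma s-(2\sigma-1)s^{3/2}}{1+s}-\frac{(2\sigma-1)z^{3/2}}{1+z}$, and $\gamma_{**}(\sigma)$ is the positive root of $G(z,z)=0$ for $\sigma\in(1/2,1]$, with $\gamma_{**}(1/2)=+\infty$ (in which case the ratio condition is just $0<\gamma_{n+1}<\infty$). Here $\gamma_{**}(1)\approx 4.8645$, $\gamma_{**}$ is decreasing in $\sigma$, and $G(s,z)\ge 0$ for $0<s,z\le\gamma_{**}(\sigma)$. Inverse operators: for $u\in L^2(\Omega)$ with $\int_\Omega u\,d\mathbf{x}=0$, $(-\Delta)^{-1}u=\psi$ is the periodic solution of $-\Delta\psi=u$, $\int_\Omega\psi\,d\mathbf{x}=0$, and $\|\nabla^{-1}u\|^2:=((-\Delta)^{-1}u,u)$. The functions $\phi^n$ are real-valued, periodic and sufficiently regular for the equations to make sense ($\phi^n\in H^4_{per}$, $\mu^{n+\sigma}\in H^2_{per}$), and the $r^n$ are real numbers. The starting values $\phi^0,\phi^1,r^1$ are given with $\int_\Omega\phi^1\,d\mathbf{x}=\int_\Omega\phi^0\,d\mathbf{x}$ (as holds when $\phi^1,r^1$ are computed from $\phi^0,r^0$ by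 the first-order scheme $\frac{\phi^1-\phi^0}{\tau_1}=\Delta\mu^1$, $\mu^1=(\Delta+\beta)^2\phi^1+S\phi^1+\frac{r^1}{\sqrt{E_1(\phi^0)+C_0}}F'(\phi^0)$, $r^1-r^0=\frac{1}{2\sqrt{E_1(\phi^0)+C_0}}\int_\Omega F'(\phi^0)(\phi^1-\phi^0)\,d\mathbf{x}$). *)

(* Defs.v *)
From HB Require Import structures.
From mathcomp Require Import all_boot all_order all_algebra.
From mathcomp Require Import all_classical all_reals all_analysis.

Set Implicit Arguments.
Unset Strict Implicit.
Unset Printing Implicit Defensive.

Import Order.TTheory GRing.Theory Num.Theory.
Import numFieldNormedType.Exports.

Local Open Scope classical_set_scope.
Local Open Scope ring_scope.

Definition measure_rV_display : measure_display -> measure_display.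
Proof. exact. Qed.

Section measurable_rV.
Context (R : realType) (d : nat).

(* The sigma-algebra generated by the coordinates, i.e. the Borel sets of R^d,
   as the library does for tuples. *)
Let coors : 'I_d -> 'rV[R]_d -> R := fun i x => x ord0 i.

Let rV_set0 : g_sigma_preimage coors set0.
Proof. exact: sigma_algebra0. Qed.

Let rV_setC A : g_sigma_preimage coors A -> g_sigma_preimage coors (~` A).
Proof. exact: sigma_algebraC. Qed.

Let rV_bigcup (F : (set 'rV[R]_d)^nat) :
  (forall i, g_sigma_preimage coors (F i)) ->
  g_sigma_preimage coors (\bigcup_i (F i)).
Proof. exact: sigma_algebra_bigcup. Qed.

HB.instance Definition _ := @isMeasurable.Build
  (measure_rV_display default_measure_display)
  'rV[R]_d (g_sigma_preimage coors) rV_set0 rV_setC rV_bigcup.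

Lemma measurable_coord (i : 'I_d) :
  measurable_fun [set: 'rV[R]_d] (fun x : 'rV[R]_d => x ord0 i).
Proof.
move=> _ Y mY; rewrite setTI; apply: sub_sigma_algebra => /=.
rewrite -bigcup_seq/=; exists i => /=; first by rewrite mem_index_enum.
by exists Y => //; rewrite setTI.
Qed.

Lemma measurable_fun_rV dT (T : measurableType dT) (f : T -> 'rV[R]_d) :
  (forall i, measurable_fun [set: T] (fun t => f t ord0 i)) ->
  measurable_fun [set: T] f.
Proof.
move=> mf; suff pre_meas : preimage_set_system setT f (g_sigma_preimage coors)
    `<=` measurable.
  by move=> _ A mA; apply: pre_meas; exists A.
rewrite -g_sigma_preimage_comp.
apply: smallest_sub; first exact: sigma_algebra_measurable.
by rewrite -bigcup_seq; apply: bigcup_sub => i _ A [B mB <-]; exact: mf.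
Qed.

End measurable_rV.

Section lebesgue_measure_rV.
Context (R : realType).

Section step.
Context (d : nat) (m : {sigma_finite_measure set 'rV[R]_d -> \bar R}).

Definition cons_rV (p : measurableTypeR R * 'rV[R]_d) : 'rV[R]_d.+1 :=
  row_mx (p.1%:M : 'rV_1) p.2.

Definition uncons_rV (x : 'rV[R]_d.+1) : measurableTypeR R * 'rV[R]_d :=
  (x ord0 ord0, \row_i x ord0 (lift ord0 i)).

Lemma cons_rV0 p : cons_rV p ord0 ord0 = p.1.
Proof.
rewrite /cons_rV mxE; case: splitP => [j _|k] //=.
by rewrite mxE (ord1 j) eqxx mulr1n.
Qed.

Lemma cons_rVS p i : cons_rV p ord0 (lift ord0 i) = p.2 ord0 i.
Proof.
rewrite /cons_rV mxE; case: splitP => [j|k] /=; first by rewrite ord1.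
by rewrite /bump leq0n !add1n => -[ik]; congr (_ _ _); apply/val_inj.
Qed.

Lemma cons_rVK : cancel cons_rV uncons_rV.
Proof.
move=> [x y]; rewrite /uncons_rV cons_rV0; congr pair.
by apply/rowP => i; rewrite mxE cons_rVS.
Qed.

Lemma measurable_cons_rV : measurable_fun setT cons_rV.
Proof.
apply: measurable_fun_rV => i; case: (unliftP ord0 i) => [j|] ->.
  under eq_fun do rewrite cons_rVS.
  by apply: (measurableT_comp (@measurable_coord R d j)); exact: measurable_snd.
by under eq_fun do rewrite cons_rV0; exact: measurable_fst.
Qed.

Lemma measurable_uncons_rV : measurable_fun setT uncons_rV.
Proof.
apply: (@measurable_fun_pair _ _ _ _ _ _ (fun x : 'rV[R]_d.+1 => x ord0 ord0 : measurableTypeR R)).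
  exact: measurable_coord.
apply: measurable_fun_rV => i.
by under eq_fun do rewrite mxE; exact: measurable_coord.
Qed.

Definition lebesgue_step : set 'rV[R]_d.+1 -> \bar R :=
  pushforward (@lebesgue_measure R \x m)%E cons_rV.

Let step_preimage (A : set 'rV[R]_d.+1) :
  measurable A -> measurable (cons_rV @^-1` A).
Proof. by move=> mA; rewrite -[X in measurable X]setTI; exact: measurable_cons_rV. Qed.

Let step0 : lebesgue_step set0 = 0%E.
Proof. by rewrite /lebesgue_step /pushforward preimage_set0 measure0. Qed.

Let step_ge0 A : (0 <= lebesgue_step A)%E.
Proof. by rewrite /lebesgue_step /pushforward. Qed.

Let step_sigma_additive : semi_sigma_additive lebesgue_step.
Proof.
move=> F mF tF mUF; rewrite /lebesgue_step /pushforward preimage_bigcup.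
apply: measure_semi_sigma_additive.
- by move=> n; exact: step_preimage.
- apply/trivIsetP => /= i j _ _ ij; rewrite -preimage_setI.
  by move/trivIsetP : tF => /(_ _ _ _ _ ij) ->//; rewrite preimage_set0.
- by rewrite -preimage_bigcup; exact: step_preimage.
Qed.

HB.instance Definition _ := isMeasure.Build _ _ _ lebesgue_step
  step0 step_ge0 step_sigma_additive.

Let step_sigma_finite : sigma_finite setT lebesgue_step.
Proof.
have /sigma_finiteP[F [TF ndF Foo]] := sigma_finiteT (@lebesgue_measure R).
have /sigma_finiteP[G [TG ndG Goo]] := sigma_finiteT m.
exists (fun k => uncons_rV @^-1` (F k `*` G k)).
  apply/esym/seteqP; split=> // x _.
  have [[i _ Fx] [j _ Gx]] : (\bigcup_k F k) (uncons_rV x).1 /\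
      (\bigcup_k G k) (uncons_rV x).2 by rewrite -TF -TG.
  exists (maxn i j) => //; split.
    exact: (subsetPset _ _ (ndF _ _ (leq_maxl i j))).
  exact: (subsetPset _ _ (ndG _ _ (leq_maxr i j))).
move=> k; have [mF Fk] := Foo k; have [mG Gk] := Goo k.
have mFG : measurable (F k `*` G k) by exact: measurableX.
split; first by rewrite -[X in measurable X]setTI; exact: measurable_uncons_rV.
rewrite /lebesgue_step /pushforward -comp_preimage.
rewrite (_ : uncons_rV \o cons_rV = id); last exact/funext/cons_rVK.
by rewrite preimage_id product_measure1E// lte_mul_pinfty// ge0_fin_numE.
Qed.

HB.instance Definition _ := Measure_isSigmaFinite.Build _ _ _ lebesgue_step
  step_sigma_finite.

End step.

Fixpoint lebesgue_rV (d : nat) : {sigma_finite_measure set 'rV[R]_d -> \bar R} :=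
  match d with
  | 0 => \d_(0 : 'rV[R]_0)
  | d'.+1 => lebesgue_step (lebesgue_rV d')
  end.

End lebesgue_measure_rV.

Section periodic_sobolev.
Context (R : realType) (d : nat) (a b : 'rV[R]_d).

Definition box : set 'rV[R]_d :=
  [set x | forall i, a ord0 i <= x ord0 i <= b ord0 i].

Lemma measurable_box : measurable box.
Proof.
rewrite (_ : box = \bigcap_(i in [set: 'I_d])
    ((fun x : 'rV[R]_d => x ord0 i) @^-1` `[a ord0 i, b ord0 i])); last first.
  apply/seteqP; split=> x /= xab i; first by move=> _; rewrite /= in_itv/= xab.
  by have := xab i Logic.I; rewrite /= in_itv.
apply: fin_bigcap_measurable => // i _.
by rewrite -[X in measurable X]setTI; exact: measurable_coord.
Qed.

(* Lebesgue measure on R^d restricted to the box. *)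
Definition dx : {measure set 'rV[R]_d -> \bar R} :=
  mrestr (lebesgue_rV R d) measurable_box.

Implicit Types (u v w psi : 'rV[R]_d -> R) (i : 'I_d).

(* Functions on the box are functions on R^d regarded up to dx-negligible
   sets; in particular their values outside the box are irrelevant. *)
Definition L2 u : Prop := u \in Lfun dx 2%:E.

Definition inner u v : R := \int[dx]_x (u x * v x).

Definition sqnorm u : R := inner u u.

Definition L2cvg (v : nat -> 'rV[R]_d -> R) u : Prop :=
  Lnorm dx 2%:E (EFin \o (v j \- u)) @[j --> \oo] --> 0%E.

Definition basis_vec i : 'rV[R]_d := delta_mx ord0 i.

Definition partial i v : 'rV[R]_d -> R := fun x => 'D_(basis_vec i) v x.

Definition iter_partial (s : seq 'I_d) v : 'rV[R]_d -> R := foldr partial v s.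

Definition periodic v : Prop :=
  forall x i, v (x + (b ord0 i - a ord0 i) *: basis_vec i) = v x.

Definition smooth v : Prop :=
  forall s, continuous (iter_partial s v) /\
    (forall x i, derivable (iter_partial s v) x (basis_vec i)).

Definition smooth_per v : Prop := smooth v /\ periodic v.

Definition classical_laplacian v : 'rV[R]_d -> R :=
  fun x => \sum_i partial i (partial i v) x.

(* H^k_per is the closure of the smooth periodic functions in the H^k(box)
   norm: all the derivatives of order at most k of the approximating sequence
   converge in L^2. *)
Definition Hper (k : nat) u : Prop :=
  L2 u /\ exists v : nat -> 'rV[R]_d -> R,
    [/\ forall j, smooth_per (v j), L2cvg v u &
        forall s : seq 'I_d, (size s <= k)%N ->
          exists2 w, L2 w & L2cvg (fun j => iter_partial s (v j)) w].

(* The (strong L^2) Laplacian of a function of H^2_per, unique up to a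
   negligible set. *)
Definition is_laplacian u w : Prop :=
  L2 w /\ exists v : nat -> 'rV[R]_d -> R,
    [/\ forall j, smooth_per (v j), L2cvg v u &
        L2cvg (fun j => classical_laplacian (v j)) w].

Definition lap u : 'rV[R]_d -> R := xget (cst 0) [set w | is_laplacian u w].

(* psi = (-Delta)^{-1} u *)
Definition is_inv_neg_laplacian u psi : Prop :=
  [/\ Hper 2 psi, \- lap psi = u %[ae dx] & \int[dx]_x psi x = 0].

End periodic_sobolev.

Section pfc_scheme.
Context (R : realType) (d : nat) (a b : 'rV[R]_d).
Context (beta eps S C0 sigma : R).

Implicit Types (f g : 'rV[R]_d -> R) (phi psi mu : nat -> 'rV[R]_d -> R).
Implicit Types (t gamma r : nat -> R) (n : nat).

Definition Fnl (p : R) : R := 4^-1 * p ^+ 4 - (S + eps) / 2 * p ^+ 2.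

Definition E1 f : R := \int[dx a b]_x Fnl (f x).

Definition lap_beta f : 'rV[R]_d -> R := fun x => lap a b f x + beta * f x.

Definition lap_beta_sq f : 'rV[R]_d -> R := fun x =>
  lap a b (lap a b f) x + 2 * beta * lap a b f x + beta ^+ 2 * f x.

Definition Ebar f (q : R) : R :=
  2^-1 * sqnorm a b (lap_beta f) + S / 2 * sqnorm a b f + q ^+ 2.

Definition tau t n : R := t n - t n.-1.

Definition mesh (M : nat) (T : R) t : Prop :=
  [/\ t 0 = 0, t M = T & forall n, (n < M)%N -> t n < t n.+1].

Definition phi_sigma phi n : 'rV[R]_d -> R := fun x =>
  sigma * phi n.+1 x + (1 - sigma) * phi n x.

Definition phi_star gamma phi n : 'rV[R]_d -> R := fun x =>
  phi n x + sigma * gamma n.+1 * (phi n x - phi n.-1 x).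

Definition F2 t gamma phi n : 'rV[R]_d -> R := fun x =>
  (tau t n.+1)^-1 *
  ((1 + 2 * sigma * gamma n.+1) / (1 + gamma n.+1) * phi n.+1 x
   - (1 + (2 * sigma - 1) * gamma n.+1) * phi n x
   + (2 * sigma - 1) * gamma n.+1 ^+ 2 / (1 + gamma n.+1) * phi n.-1 x).

Definition G (s z : R) : R :=
  (2 + 4 * sigma * s - (2 * sigma - 1) * s `^ (3 / 2)) / (1 + s)
  - (2 * sigma - 1) * z `^ (3 / 2) / (1 + z).

(* For sigma in (1/2, 1] the set is a singleton. *)
Definition gamma_starstar : \bar R :=
  if sigma == 2^-1 then +oo%E
  else (xget 0 [set z | 0 < z /\ G z z = 0])%:E.

(* One step of the scheme, with mu n standing for mu^{n + sigma}. *)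
Definition scheme_step t gamma phi mu r n : Prop :=
  [/\ F2 t gamma phi n = lap a b (mu n) %[ae dx a b],
      mu n = (fun x => lap_beta_sq (phi_sigma phi n) x + S * phi_sigma phi n x
               + r n.+1 / Num.sqrt (E1 (phi n) + C0)
                 * derive1 Fnl (phi_star gamma phi n x)) %[ae dx a b] &
      (r n.+1 - r n) / tau t n.+1 =
        (2 * Num.sqrt (E1 (phi n) + C0))^-1
        * \int[dx a b]_x (derive1 Fnl (phi_star gamma phi n x)
                          * ((phi n.+1 x - phi n x) / tau t n.+1))].

(* psi n stands for (-Delta)^{-1} (phi^n - phi^{n-1}), so that the inner
   product is the squared norm of nabla^{-1} (phi^n - phi^{n-1}). *)
Definition Etilde t gamma phi psi r n : R :=
  Ebar (phi n) (r n)
  + (2 * sigma - 1) * gamma n.+1 `^ (3 / 2) / (2 + 2 * gamma n.+1)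
    * (inner a b (psi n) (phi n \- phi n.-1) / tau t n).

End pfc_scheme.

(* Main.v *)
Require Import Defs.
From mathcomp Require Import all_boot all_order all_algebra.
From mathcomp Require Import all_classical all_reals all_analysis.
From mathcomp Require Import measurable_realfun ring lra.

Set Implicit Arguments.
Unset Strict Implicit.
Unset Printing Implicit Defensive.

Import Order.TTheory GRing.Theory Num.Theory.
Import numFieldNormedType.Exports.

Local Open Scope classical_set_scope.
Local Open Scope ring_scope.

(** Put D = phi^(n+1) - phi^n and D' = phi^n - phi^(n-1), and write (.,.)_(-1)
for the inner product ((-Delta)^(-1) . , .) of functions of the form
Delta psi.  The difference quotient F_2 only involves the two increments:
tau F_2 = p D - q D' with p = (1 + 2 sigma gamma) / (1 + gamma) and
q = (2 sigma - 1) gamma^2 / (1 + gamma).  Testing F_2 = Delta mu with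
(-Delta)^(-1) D therefore gives

  (p (D, D)_(-1) - q (D', D)_(-1)) / tau = - (mu, D).

On the left, Young's inequality with the weight sqrt gamma splits the cross
term into the two diagonal ones ([inv_neg_laplacian_young]); since
gamma = tau_(n+1) / tau_n, the part carried by D' is exactly the correction
term of the modified energy at time n, and what is left of the part carried
by D exceeds the correction term at time n+1 by a nonnegative multiple of
G(gamma_(n+1), gamma_(n+2)) ([G_young_le]).

On the right, (mu, D) is at least the increase of the energy
(1/2) |(Delta + beta) phi|^2 + (S/2) |phi|^2 + r^2.  The quadratic terms use
(w, v - u) >= (|v|^2 - |u|^2) / 2 for w = sigma v + (1 - sigma) u with
sigma >= 1/2 ([energy_step_le]); the equation for r turns the nonlinear term
into 2 r^(n+1) (r^(n+1) - r^n) >= (r^(n+1))^2 - (r^n)^2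
([inner_scheme_mu]).  Adding the two sides proves the claim.

That G >= 0 up to the threshold ([G_ge0]) is an inequality between cubics in
the square roots of the ratios.  The functional analysis is limited to the
symmetry, negativity and uniqueness of the strong Laplacian.  All three pass
to L^2 limits from smooth periodic functions, where they are Green's formula;
the boundary terms vanish because the integral over the box of a partial
derivative of a periodic function is zero ([integral_box_partial], Fubini and
the fundamental theorem of calculus). *)

(** * Integration over the box *)

(** The sigma-algebra is generated by the coordinates and not by the open sets,
so a continuous f is exhibited as the pointwise limit of its values at the
lower corners of the cells of the grid of mesh 1 / (k + 1); these functions
take countably many values, on finite intersections of coordinate slabs. *)
Lemma continuous_measurable_rV (R : realType) (d : nat) (f : 'rV[R]_d -> R) :
  continuous f -> measurable_fun [set: 'rV[R]_d] f.
Proof.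
move=> cf.
pose grid (k : nat) (x : 'rV[R]_d) : 'rV[R]_d :=
  \row_i ((Num.floor (k.+1%:R * x ord0 i))%:~R / k.+1%:R).
have gridP k x i : `|grid k x ord0 i - x ord0 i| <= k.+1%:R^-1.
  rewrite mxE; set y := x ord0 i; set m := Num.floor _.
  have k0 : 0 < k.+1%:R :> R by rewrite ltr0n.
  have /andP[h1 h2] := floor_itv (k.+1%:R * y).
  rewrite -[y](mulfK (lt0r_neq0 k0)) -mulrBl normrM normfV (gtr0_norm k0).
  rewrite ler_pdivrMr// mulVf ?gt_eqF//.
  rewrite -/m intrD in h1 h2.
  by rewrite ler_norml; apply/andP; split; lra.
apply: (@measurable_fun_cvg _ _ _ _ (fun k => f \o grid k)); last first.
  move=> x _; apply: (cvg_comp (fun k => grid k x) f); last exact: cf.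
  apply/cvg_ballP => e e0.
  have [N _ hN] : \forall n \near \oo, n.+1%:R^-1 < e.
    exact: near_infty_natSinv_lt (PosNum e0).
  exists N => // n /= Nn; split=> // i j; rewrite (ord1 i).
  rewrite -ball_normE/= distrC (le_lt_trans (gridP n x j))//; exact: hN.
move=> k _ Y mY; rewrite setTI.
pose c (m : 'rV[int]_d) : 'rV[R]_d := \row_i ((m ord0 i)%:~R / k.+1%:R).
have -> : (f \o grid k) @^-1` Y =
  \bigcup_(m in [set m | Y (f (c m))]) \bigcap_(i in [set: 'I_d])
    ((fun x : 'rV[R]_d => Num.floor (k.+1%:R * x ord0 i)) @^-1` [set m ord0 i]).
  apply/seteqP; split => [x /= Yx|x [m /= Ym] hx].
    exists (\row_i Num.floor (k.+1%:R * x ord0 i)) => /=.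
      by rewrite (_ : c _ = grid k x)//; apply/rowP => i; rewrite !mxE.
    by move=> i _ /=; rewrite mxE.
  rewrite /= (_ : grid k x = c m)//; apply/rowP => i; rewrite !mxE.
  by have /= -> := hx i Logic.I.
rewrite bigcup_mkcond.
apply: countable_bigcupT_measurable => [|m]; first exact: countableP.
case: ifPn => // _; apply: fin_bigcap_measurable => // i _.
rewrite (_ : _ @^-1` _ = (fun x : 'rV[R]_d => x ord0 i) @^-1`
    `[(m ord0 i)%:~R / k.+1%:R, (m ord0 i + 1)%:~R / k.+1%:R[).
  by rewrite -[X in measurable X]setTI; exact: measurable_coord.
have k0 : 0 < k.+1%:R :> R by rewrite ltr0n.
apply/seteqP; split => x /=; rewrite in_itv/= ler_pdivrMr// ltr_pdivlMr// mulrC.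
  by move=> <-; exact: floor_itv.
by move=> h; exact/floor_def.
Qed.

Notation tail_rV x := (uncons_rV x).2.

Lemma continuous_bounded_box (R : realType) (d : nat) (a b : 'rV[R]_d)
    (f : 'rV[R]_d -> R) :
  continuous f -> exists M, forall x, box a b x -> `|f x| <= M.
Proof.
move=> cf; have cbox : compact (box a b).
  rewrite (_ : box a b = [set v | forall i, `[a ord0 i, b ord0 i]%classic (v ord0 i)]).
    apply: (@rV_compact _ d (fun i => `[a ord0 i, b ord0 i]%classic)) => i.
    exact: segment_compact.
  by apply/seteqP; split => x /= h i; have := h i; rewrite /= in_itv.
have [box0|] := pselect (box a b !=set0); last first.
  by move/set0P/negP/negPn/eqP => ->; exists 0.
have [c _ hc] : exists2 c, c \in box a b &
    forall x, x \in box a b -> `|f x| <= `|f c|.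
  apply: (EVT_max_rV (f := (@Num.norm R R) \o f) box0 cbox).
  apply: continuous_subspaceT => x.
  by apply: continuous_comp; [exact: cf|exact: norm_continuous].
by exists `|f c| => x bx; apply: hc; rewrite inE.
Qed.

Lemma cons_rV_box (R : realType) (d : nat) (a b : 'rV[R]_d.+1) p :
  box a b (cons_rV p) <->
  `[a ord0 ord0, b ord0 ord0]%classic p.1 /\ box (tail_rV a) (tail_rV b) p.2.
Proof.
split=> [h|[h0 h1] i].
  split=> [|i]; first by have := h ord0; rewrite cons_rV0 /= in_itv.
  by have := h (lift ord0 i); rewrite cons_rVS !mxE.
case: (unliftP ord0 i) => [j|] ->; first by have := h1 j; rewrite cons_rVS !mxE.
by rewrite cons_rV0; move: h0; rewrite /= in_itv.
Qed.

Lemma lebesgue_rV_box_lty (R : realType) (d : nat) (a b : 'rV[R]_d) :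
  (lebesgue_rV R d (box a b) < +oo)%E.
Proof.
elim: d a b => [|d IH] a b; first by rewrite /= diracE ltry.
have fl : (@lebesgue_measure R `[a ord0 ord0, b ord0 ord0]%classic < +oo)%E.
  by rewrite lebesgue_measure_itv/=; case: ifPn; rewrite ?ltry// -EFinD ltry.
rewrite /= /lebesgue_step /pushforward.
rewrite (_ : _ @^-1` _ =
    `[a ord0 ord0, b ord0 ord0]%classic `*` box (tail_rV a) (tail_rV b)).
  rewrite product_measure1E//; last exact: measurable_box.
  rewrite lte_mul_pinfty ?IH// ge0_fin_numE//; exact: fl.
by apply/seteqP; split => p /cons_rV_box.
Qed.

Lemma integrable_box (R : realType) (d : nat) (a b : 'rV[R]_d)
    (f : 'rV[R]_d -> R) :
  continuous f -> (lebesgue_rV R d).-integrable (box a b) (EFin \o f).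
Proof.
move=> cf; apply: measurable_bounded_integrable.
- exact: measurable_box.
- exact: lebesgue_rV_box_lty.
- by apply: measurable_funTS; exact: continuous_measurable_rV.
- have [M hM] := continuous_bounded_box a b cf.
  exists M; split; first exact: num_real.
  by move=> y My x bx; apply: le_trans (hM x bx) (ltW My).
Qed.

(** The two measures agree on the measurable subsets of the box, and the
complement of the box is negligible for [dx a b]. *)
Lemma integral_dx (R : realType) (d : nat) (a b : 'rV[R]_d)
    (f : 'rV[R]_d -> \bar R) :
  measurable_fun [set: 'rV[R]_d] f ->
  (\int[dx a b]_x f x = \int[lebesgue_rV R d]_(x in box a b) f x)%E.
Proof.
move=> mf.
have mbox := measurable_box a b.
have -> : (\int[lebesgue_rV R d]_(x in box a b) f x = \int[dx a b]_(x in box a b) f x)%E.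
  apply: eq_measure_integral => A mA Ab.
  by rewrite /dx/= /mrestr setIidl.
have ge0 (g : 'rV[R]_d -> \bar R) :
    measurable_fun [set: 'rV[R]_d] g -> (forall x, 0 <= g x)%E ->
    (\int[dx a b]_x g x = \int[dx a b]_(x in box a b) g x)%E.
  move=> mg g0; rewrite (@ge0_negligible_integral _ _ _ _ setT (~` box a b))//.
  - by rewrite setTD setCK.
  - exact: measurableC.
  - by rewrite /dx /= /mrestr setICl measure0.
rewrite integralE [RHS]integralE; congr (_ - _)%E; apply: ge0 => //.
- exact: measurable_funepos.
- exact: measurable_funeneg.
Qed.

(** Fubini's theorem for one coordinate against the others.  It is applied to the
extension by zero of g, so that the domain is the whole product space. *)
Section fubini_step.
Context (R : realType) (d : nat) (a b : 'rV[R]_d.+1) (g : 'rV[R]_d.+1 -> R).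
Hypothesis cg : continuous g.

Let h : 'rV[R]_d.+1 -> \bar R := (EFin \o g) \_ (box a b).

Let mh : measurable_fun [set: 'rV[R]_d.+1] h.
Proof.
apply/(measurable_restrictT _ _).1; first exact: measurable_box.
apply/measurable_EFinP; apply: measurable_funTS; exact: continuous_measurable_rV.
Qed.

Let ih :
  (lebesgue_measure \x lebesgue_rV R d)%E.-integrable setT (h \o @cons_rV R d).
Proof.
have mcons := @measurable_cons_rV R d.
apply/integrableP; split; first exact: measurableT_comp.
have /integrableP[_] :=
  (integrable_mkcond _ (measurable_box a b)).1 (integrable_box a b cg).
rewrite /= ge0_integral_pushforward//; exact: measurableT_comp.
Qed.

Let hE x y : h (cons_rV (x, y)) =
  if x \in `[a ord0 ord0, b ord0 ord0]%classic then
    if y \in box (tail_rV a) (tail_rV b) then (g (cons_rV (x, y)))%:E else 0%E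
  else 0%E.
Proof.
rewrite /h patchE; have [/set_mem/cons_rV_box[/= h1 h2]|] := boolP (_ \in box _ _).
  by rewrite !mem_set.
move=> hn; case: ifPn => // /set_mem h1; case: ifPn => // /set_mem h2.
by move: hn; rewrite mem_set//; exact/cons_rV_box.
Qed.

Let integralE0 : (\int[lebesgue_rV R d.+1]_(z in box a b) (g z)%:E =
  \int[(lebesgue_measure \x lebesgue_rV R d)]_p (h (cons_rV p)))%E.
Proof.
rewrite integral_mkcond /= integral_pushforward//.
exact: measurable_cons_rV.
Qed.

Lemma integral_box_xy : (\int[lebesgue_rV R d.+1]_(z in box a b) (g z)%:E =
  \int[lebesgue_measure]_(x in `[a ord0 ord0, b ord0 ord0])
    \int[lebesgue_rV R d]_(y in box (tail_rV a) (tail_rV b)) (g (cons_rV (x, y)))%:E)%E.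
Proof.
rewrite integralE0 -integral12_prod_meas1// [RHS]integral_mkcond.
apply: eq_integral => x _; rewrite /fubini_F; under eq_integral do rewrite /= hE.
rewrite patchE; case: ifPn => hx; last by rewrite integral0.
by rewrite [RHS]integral_mkcond; apply: eq_integral => y _; rewrite patchE.
Qed.

Lemma integral_box_yx : (\int[lebesgue_rV R d.+1]_(z in box a b) (g z)%:E =
  \int[lebesgue_rV R d]_(y in box (tail_rV a) (tail_rV b))
    \int[lebesgue_measure]_(x in `[a ord0 ord0, b ord0 ord0]) (g (cons_rV (x, y)))%:E)%E.
Proof.
rewrite integralE0 -integral21_prod_meas1// [RHS]integral_mkcond.
apply: eq_integral => y _; rewrite /fubini_G; under eq_integral do rewrite /= hE.
rewrite patchE; case: ifPn => hy; last by rewrite integral0_eq// => x _; case: ifP.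
by rewrite [RHS]integral_mkcond; apply: eq_integral => x _; rewrite patchE.
Qed.

End fubini_step.

Lemma continuous_cons_rVr (R : realType) (d : nat) (x : R) :
  continuous (fun y : 'rV[R]_d => cons_rV (x, y)).
Proof.
move=> y; have FF := @nbhs_filter _ y.
have ? := fmap_filter (fun y : 'rV[R]_d => cons_rV (x, y)) FF.
apply/cvg_ballP => e e0.
apply: (@filterS _ (nbhs y) _ (ball y e)) (nbhsx_ballx y e e0) => z [_ yz].
split=> // i j; rewrite (ord1 i).
case: (unliftP ord0 j) => [k|] ->; rewrite ?cons_rV0 ?cons_rVS//=; exact: ballxx.
Qed.

Lemma continuous_cons_rVl (R : realType) (d : nat) (y : 'rV[R]_d) :
  continuous (fun x : R => cons_rV (x, y)).
Proof.
move=> x; have FF := @nbhs_filter _ x.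
have ? := fmap_filter (fun x : R => cons_rV (x, y)) FF.
apply/cvg_ballP => e e0.
apply: (@filterS _ (nbhs x) _ (ball x e)) (nbhsx_ballx x e e0) => z xz.
split=> // i j; rewrite (ord1 i).
case: (unliftP ord0 j) => [k|] ->; rewrite ?cons_rV0 ?cons_rVS//=; exact: ballxx.
Qed.

Lemma basis_vecE (R : realType) (d : nat) (i j : 'I_d) :
  basis_vec R i ord0 j = (j == i)%:R.
Proof. by rewrite mxE eqxx. Qed.

Lemma cons_rV_basis0 (R : realType) (d : nat) (h x : R) (y : 'rV[R]_d) :
  h *: basis_vec R ord0 + cons_rV (x, y) = cons_rV (h + x, y).
Proof.
apply/rowP => j; rewrite mxE [X in X + _]mxE basis_vecE.
case: (unliftP ord0 j) => [k|] ->.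
  by rewrite !cons_rVS -(inj_eq val_inj) /= mulr0 add0r.
by rewrite !cons_rV0 eqxx mulr1.
Qed.

Lemma cons_rV_basisS (R : realType) (d : nat) (i : 'I_d) (h x : R) (y : 'rV[R]_d) :
  h *: basis_vec R (lift ord0 i) + cons_rV (x, y) = cons_rV (x, h *: basis_vec R i + y).
Proof.
apply/rowP => j; rewrite mxE [X in X + _]mxE basis_vecE.
case: (unliftP ord0 j) => [k|] ->.
  by rewrite !cons_rVS mxE [X in _ = X + _]mxE basis_vecE (inj_eq lift_inj).
by rewrite !cons_rV0 -(inj_eq val_inj)/= mulr0 add0r.
Qed.

(** A directional derivative only depends on the values along the line.  This
transfers derivatives between a function and its partial applications, and
along a period. *)
Section derive_along.
Context (R : realType) (V V' : normedModType R).
Context (f : V -> R) (g : V' -> R) (x v : V) (y w : V').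
Hypothesis fg : forall h : R, f (h *: v + x) = g (h *: w + y).

Let fgE : (fun h : R => h^-1 *: ((f \o shift x) (h *: v) - f x)) =
  (fun h : R => h^-1 *: ((g \o shift y) (h *: w) - g y)).
Proof.
have fxgy : f x = g y by have := fg 0; rewrite !scale0r !add0r.
by apply/funext => h /=; rewrite fg fxgy.
Qed.

Lemma derive_along : 'D_v f x = 'D_w g y.
Proof. by rewrite /derive fgE. Qed.

Lemma derivable_along : derivable f x v -> derivable g y w.
Proof. by rewrite /derivable fgE. Qed.

End derive_along.

(** Induction on the dimension, peeling off the first coordinate.  If it is the
direction of differentiation, the inner integral is a difference of values of
f at two points one period apart; otherwise the induction hypothesis kills the
integral over the other coordinates. *)
Lemma integral_box_partial (R : realType) (d : nat) (a b : 'rV[R]_d) (i : 'I_d)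
    (f : 'rV[R]_d -> R) :
  (forall j, a ord0 j < b ord0 j) ->
  (forall x, derivable f x (basis_vec R i)) -> continuous (partial i f) ->
  (forall x, f (x + (b ord0 i - a ord0 i) *: basis_vec R i) = f x) ->
  (\int[lebesgue_rV R d]_(x in box a b) (partial i f x)%:E = 0)%E.
Proof.
elim: d a b i f => [|d IH] a b i f ab df cf per; first by case: i df cf per.
case: (unliftP ord0 i) df cf per => [j|] -> df cf per.
  rewrite integral_box_xy// integral0_eq// => x _.
  have shiftE (y : 'rV[R]_d) h : f (h *: basis_vec R (lift ord0 j) + cons_rV (x, y)) =
      f (cons_rV (x, h *: basis_vec R j + y)) by rewrite cons_rV_basisS.
  have dE y : partial (lift ord0 j) f (cons_rV (x, y)) =
      partial j (fun y => f (cons_rV (x, y))) y.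
    exact/derive_along/shiftE.
  under eq_integral do rewrite dE.
  apply: IH.
  - by move=> k; rewrite !mxE.
  - by move=> y; apply: derivable_along (df (cons_rV (x, y))) => h; exact: shiftE.
  - rewrite (_ : partial _ _ = partial (lift ord0 j) f \o (fun y => cons_rV (x, y))).
      by move=> y; apply: continuous_comp; [apply: continuous_cons_rVr|apply: cf].
    by apply/funext => y /=; rewrite dE.
  - by move=> y; rewrite !mxE addrC -shiftE addrC per.
rewrite integral_box_yx// integral0_eq// => y _.
have shiftE (x h : R) : f (h *: basis_vec R ord0 + cons_rV (x, y)) = f (cons_rV (h + x, y)).
  by rewrite cons_rV_basis0.
pose F (x : R) : R := f (cons_rV (x, y)).
have dE (x : R) : partial ord0 f (cons_rV (x, y)) = (derive1 F) x.
  by rewrite derive1E; apply: derive_along => h; rewrite shiftE [h *: 1]mulr1.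
have dF (x : R) : derivable F x 1.
  by apply: derivable_along (df (cons_rV (x, y))) => h; rewrite shiftE [h *: 1]mulr1.
have cF : continuous F.
  by move=> x; apply/differentiable_continuous; rewrite -derivable1_diffP.
have cF' : continuous (derive1 F).
  rewrite (_ : (derive1 F) = partial ord0 f \o (fun x => cons_rV (x, y))).
    by move=> x; apply: continuous_comp; [apply: continuous_cons_rVl|apply: cf].
  by apply/funext => x /=; rewrite dE.
under eq_integral do rewrite dE.
rewrite (@continuous_FTC2 _ (derive1 F) F)//.
- rewrite -EFinB (_ : F (b _ _) = F (a ord0 ord0)) ?subrr//.
  by rewrite /F -[in RHS]per addrC cons_rV_basis0 subrK.
- exact: continuous_subspaceT.
- split=> //; [exact/cvg_at_right_filter/cF|exact/cvg_at_left_filter/cF].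
Qed.

(** * Square-integrable functions *)

(** Every linear combination below is brought to this form, so that each notion
(square integrability, inner product, L^2 limits, derivatives, H^k_per, the
Laplacian) needs a single linearity lemma. *)
Definition lin (R : realType) (T : Type) (c : R) (u v : T -> R) : T -> R :=
  fun x => c * u x + v x.

Lemma cvg_le_dist0 (R : realType) (e f : nat -> R) (l : R) :
  (forall j, `|f j - l| <= e j) -> e j @[j --> \oo] --> 0 -> f j @[j --> \oo] --> l.
Proof.
move=> h e0; apply/cvgrPdist_le => eps eps0.
have /cvgrPdist_le/(_ _ eps0) := e0; apply: filterS => j.
rewrite sub0r normrN distrC => hj; apply: le_trans (h j) (le_trans (ler_norm _) hj).
Qed.

Section L2_box.
Context (R : realType) (d : nat) (a b : 'rV[R]_d).
Implicit Types (u v w z : 'rV[R]_d -> R) (c : R).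
Notation L2 := (L2 a b).
Notation inner := (inner a b).
Notation L2cvg := (L2cvg a b).
Notation dx := (dx a b).
Notation nrm f := (fine (Lnorm dx 2%:E (EFin \o f))).

Lemma L2_measurable u : L2 u -> measurable_fun [set: 'rV[R]_d] u.
Proof. by case/andP => /set_mem. Qed.

Lemma L2_fin u : L2 u -> Lnorm dx 2%:E (EFin \o u) \is a fin_num.
Proof. by case/andP => _ /set_mem /= h; rewrite ge0_fin_numE ?Lnorm_ge0. Qed.

Lemma L2_lin c u v : L2 u -> L2 v -> L2 (lin c u v).
Proof.
move=> hu hv; have two : (1 <= 2%:E :> \bar R)%E by rewrite lee_fin ler1n.
exact: (Lfun_submod_closed dx two).2 c u v hu hv.
Qed.

Lemma L2_0 : L2 (cst 0).
Proof.
have two : (1 <= 2%:E :> \bar R)%E by rewrite lee_fin ler1n.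
exact: (Lfun_submod_closed dx two).1.
Qed.

Lemma L2_integrable u v : L2 u -> L2 v ->
  dx.-integrable [set: 'rV[R]_d] (EFin \o (fun x => u x * v x)).
Proof. by move=> hu hv; apply/Lfun1_integrable; exact: Lfun2_mul_Lfun1. Qed.

Lemma innerC u v : inner u v = inner v u.
Proof. by apply: eq_Rintegral => x _; rewrite mulrC. Qed.

Lemma inner_linl c u v w : L2 u -> L2 v -> L2 w ->
  inner (lin c u v) w = c * inner u w + inner v w.
Proof.
move=> hu hv hw; rewrite /inner /lin.
under eq_Rintegral do rewrite mulrDl -mulrA.
rewrite RintegralD//; [|by have := integrableZl measurableT c (L2_integrable hu hw)
  |exact: L2_integrable].
by rewrite RintegralZl//; exact: L2_integrable.
Qed.

Lemma inner_linr c u v w : L2 u -> L2 v -> L2 w ->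
  inner w (lin c u v) = c * inner w u + inner w v.
Proof. by move=> hu hv hw; rewrite innerC inner_linl// !(innerC _ w). Qed.

Lemma inner0l u : inner (cst 0) u = 0.
Proof.
by rewrite /inner; under eq_Rintegral do rewrite mul0r; rewrite Rintegral_cst// mul0r.
Qed.

Lemma sqnorm_ge0 u : 0 <= inner u u.
Proof. by apply: Rintegral_ge0 => x _; rewrite -expr2 sqr_ge0. Qed.

Lemma inner_ae u v w : L2 u -> L2 v -> L2 w -> u = v %[ae dx] -> inner u w = inner v w.
Proof.
move=> /L2_measurable mu /L2_measurable mv /L2_measurable mw uv; congr fine.
apply: ae_eq_integral => //; [exact/measurable_EFinP/measurable_funM..|].
by apply: filterS uv => x /= h _; rewrite h.
Qed.

Lemma inner_eq0_ae u : L2 u -> inner u u = 0 -> u = cst 0 %[ae dx].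
Proof.
move=> hu u0; have mu := L2_measurable hu.
have iu := L2_integrable hu hu.
have : (\int[dx]_x `|(EFin \o (fun x => (u x * u x)%R)) x| = 0)%E.
  rewrite -[RHS](congr1 EFin u0) /inner /Rintegral fineK.
    by apply: eq_integral => x _ /=; rewrite ger0_norm// -expr2 sqr_ge0.
  exact: integrable_fin_num.
move/(ae_eq_integral_abs _ _ _).1 => H.
have /H : measurable_fun setT (EFin \o (fun x => (u x * u x)%R)).
  exact: (measurable_int _ iu).
move=> {}H; apply: filterS (H measurableT) => x /= /(_ Logic.I) [] /eqP.
by rewrite mulf_eq0 orbb => /eqP.
Qed.

Lemma cauchy_schwarz u v : L2 u -> L2 v -> `|inner u v| <= nrm u * nrm v.
Proof.
move=> hu hv; have iuv := L2_integrable hu hv.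
apply: le_trans (le_normr_Rintegral measurableT iuv) _.
rewrite -lee_fin EFinM !fineK ?L2_fin//; last first.
  by apply: integrable_fin_num => //; exact: integrable_norm.
have half : 2^-1 + 2^-1 = 1 :> R by rewrite [RHS]splitr !div1r.
have := hoelder dx (L2_measurable hu) (L2_measurable hv) (ltr0n _ 2) (ltr0n _ 2) half.
by rewrite Lnorm1.
Qed.

Lemma nrm_ge0 u : 0 <= nrm u.
Proof. by rewrite fine_ge0// Lnorm_ge0. Qed.

Lemma linN1E (u v : 'rV[R]_d -> R) : v \- u = lin (-1) u v.
Proof. by apply/funext => x; rewrite /lin /= mulN1r addrC. Qed.

Lemma L2B u v : L2 u -> L2 v -> L2 (v \- u).
Proof. by rewrite linN1E; exact: L2_lin. Qed.

Lemma L2cvgP (p : nat -> 'rV[R]_d -> R) u : (forall j, L2 (p j)) -> L2 u ->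
  L2cvg p u <-> (nrm (p j \- u) @[j --> \oo] --> 0).
Proof.
move=> hp hu; split=> [/fine_cvgP[_]//|pu]; apply/fine_cvgP; split=> //.
by apply: nearW => j; apply: L2_fin; exact: L2B.
Qed.

Lemma inner_cvg (p q : nat -> 'rV[R]_d -> R) u v :
  (forall j, L2 (p j)) -> (forall j, L2 (q j)) -> L2 u -> L2 v ->
  L2cvg p u -> L2cvg q v -> inner (p j) (q j) @[j --> \oo] --> inner u v.
Proof.
move=> hp hq hu hv /(L2cvgP hp hu) pu /(L2cvgP hq hv) qv.
apply: (@cvg_le_dist0 _ (fun j => nrm (p j \- u) * nrm v + nrm u * nrm (q j \- v) +
    nrm (p j \- u) * nrm (q j \- v))); last first.
  have := cvgD (cvgD (cvgM pu (cvg_cst (nrm v))) (cvgM (cvg_cst (nrm u)) qv)) (cvgM pu qv).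
  by rewrite !(mul0r, mulr0, addr0); apply.
move=> j; have hP := L2B hu (hp j); have hQ := L2B hv (hq j).
have -> : inner (p j) (q j) - inner u v =
    inner (p j \- u) v + inner u (q j \- v) + inner (p j \- u) (q j \- v).
  by rewrite !linN1E !(inner_linl, inner_linr)//; [ring|rewrite -linN1E].
rewrite (le_trans (ler_normD _ _))// lerD ?cauchy_schwarz//.
by rewrite (le_trans (ler_normD _ _))// lerD ?cauchy_schwarz.
Qed.

Lemma eq_Lnorm_ae u v : L2 u -> L2 v -> u = v %[ae dx] ->
  Lnorm dx 2%:E (EFin \o u) = Lnorm dx 2%:E (EFin \o v).
Proof.
move=> /L2_measurable mu /L2_measurable mv uv; rewrite unlock /Lnorm; congr (_ `^ _)%E.
have mpow w : measurable_fun [set: 'rV[R]_d] w ->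
    measurable_fun [set: 'rV[R]_d] (fun x => `|(EFin \o w) x| `^ 2)%E.
  move=> mw; apply/measurable_EFinP/(measurableT_comp (measurable_powR _)).
  exact: measurableT_comp.
apply: ge0_ae_eq_integral => //.
- exact: mpow.
- exact: mpow.
- by move=> x _; exact: poweR_ge0.
- by move=> x _; exact: poweR_ge0.
- by apply: filterS uv => x /= h _; rewrite h.
Qed.

Lemma L2cvg_ae (p : nat -> 'rV[R]_d -> R) u v : (forall j, L2 (p j)) -> L2 u -> L2 v ->
  u = v %[ae dx] -> L2cvg p u -> L2cvg p v.
Proof.
move=> hp hu hv uv; rewrite /Defs.L2cvg.
suff -> : (fun j => Lnorm dx 2%:E (EFin \o (p j \- u))) =
  (fun j => Lnorm dx 2%:E (EFin \o (p j \- v))) by [].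
apply/funext => j; apply: eq_Lnorm_ae; [exact: L2B|exact: L2B|].
by apply: filterS uv => x /= h _; rewrite h.
Qed.

Lemma nrm_lin c u v : L2 u -> L2 v -> nrm (lin c u v) <= `|c| * nrm u + nrm v.
Proof.
move=> hu hv; have two : (1 <= 2%:E :> \bar R)%E by rewrite lee_fin ler1n.
have hcu : L2 (fun x => c * u x).
  by have := L2_lin c hu L2_0; rewrite /lin /=; under eq_fun do rewrite addr0.
rewrite -lee_fin (EFinD (`|c| * _)) (EFinM `|c|) !fineK ?L2_fin//; last exact: L2_lin.
rewrite -(LnormZ (Lfun_Sub two hu) c).
exact: (eminkowski dx (L2_measurable hcu) (L2_measurable hv) two).
Qed.

Lemma L2cvg_lin (p q : nat -> 'rV[R]_d -> R) u v c :
  (forall j, L2 (p j)) -> (forall j, L2 (q j)) -> L2 u -> L2 v ->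
  L2cvg p u -> L2cvg q v ->
  L2cvg (fun j => lin c (p j) (q j)) (lin c u v).
Proof.
move=> hp hq hu hv /(L2cvgP hp hu) pu /(L2cvgP hq hv) qv.
apply/L2cvgP; [by move=> j; exact: L2_lin|exact: L2_lin|].
apply: (@cvg_le_dist0 _ (fun j => `|c| * nrm (p j \- u) + nrm (q j \- v))).
  move=> j; rewrite subr0 ger0_norm ?nrm_ge0//.
  apply: le_trans (nrm_lin c (L2B hu (hp j)) (L2B hv (hq j))).
  rewrite le_eqVlt; apply/orP; left; apply/eqP; do 3!f_equal.
  by apply/funext => x; rewrite /lin/=; ring.
by have := cvgD (cvgM (cvg_cst `|c|) pu) qv; rewrite mulr0 addr0; apply.
Qed.

Lemma L2cvg_cst u : L2cvg (fun=> u) u.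
Proof.
rewrite /Defs.L2cvg (_ : (fun=> _) = cst 0%E); first exact: cvg_cst.
apply/funext => j; rewrite (_ : EFin \o _ = cst 0%E) ?Lnorm0//.
by apply/funext => x /=; rewrite subrr.
Qed.

End L2_box.

(** * Smooth periodic functions *)

Section smooth_periodic.
Context (R : realType) (d : nat) (a b : 'rV[R]_d).
Implicit Types (u v w z : 'rV[R]_d -> R) (c : R) (i : 'I_d) (s : seq 'I_d).
Notation periodic := (Defs.periodic a b).
Notation smooth_per := (smooth_per a b).
Notation L2 := (L2 a b).
Notation inner := (inner a b).

Lemma smooth_continuous v : smooth v -> continuous v.
Proof. by move=> /(_ [::])[]. Qed.

Lemma smooth_derivable v x i : smooth v -> derivable v x (basis_vec R i).
Proof. by move=> /(_ [::])[_]. Qed.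

Lemma iter_partial_partial s i v :
  iter_partial s (partial i v) = iter_partial (rcons s i) v.
Proof. by rewrite /iter_partial foldr_rcons. Qed.

Lemma smooth_partial i v : smooth v -> smooth (partial i v).
Proof. by move=> sv s; rewrite iter_partial_partial. Qed.

Lemma smooth_iter s v : smooth v -> smooth (iter_partial s v).
Proof. by move=> sv; elim: s => [//|i s IH]; exact: smooth_partial i _ IH. Qed.

Lemma partial_lin i c u v : smooth u -> smooth v ->
  partial i (lin c u v) = lin c (partial i u) (partial i v).
Proof.
move=> su sv; apply/funext => x; rewrite /partial /lin.
have du := @smooth_derivable _ x i su; have dv := @smooth_derivable _ x i sv.
have := deriveD (derivableZ (k := c) du) dv; rewrite (deriveZ c du); exact.
Qed.

Lemma iter_partial_lin s c u v : smooth u -> smooth v ->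
  iter_partial s (lin c u v) = lin c (iter_partial s u) (iter_partial s v).
Proof.
move=> su sv; elim: s => [//|i s IH].
rewrite /iter_partial /= -!/(iter_partial _ _) IH.
by rewrite (partial_lin i c (smooth_iter s su) (smooth_iter s sv)).
Qed.

Lemma smooth_lin c u v : smooth u -> smooth v -> smooth (lin c u v).
Proof.
move=> su sv s; rewrite iter_partial_lin//.
have [cu du] := su s; have [cv dv] := sv s; split=> [x|x i].
  by have := cvgD (cvgM (cvg_cst c) (cu x)) (cv x); apply.
by apply: derivableD => //; exact: derivableZ.
Qed.

Lemma periodic_lin c u v : periodic u -> periodic v -> periodic (lin c u v).
Proof. by move=> pu pv x i; rewrite /lin pu pv. Qed.

Lemma periodic_partial i v : periodic v -> periodic (partial i v).
Proof.
move=> pv x j; apply: derive_along => h.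
by rewrite addrA pv.
Qed.

Lemma smooth_per_lin c u v : smooth_per u -> smooth_per v -> smooth_per (lin c u v).
Proof.
by move=> [su pu] [sv pv]; split; [exact: smooth_lin|exact: periodic_lin].
Qed.

Lemma smooth_per_partial i v : smooth_per v -> smooth_per (partial i v).
Proof. by move=> [sv pv]; split; [exact: smooth_partial|exact: periodic_partial]. Qed.

Lemma smooth_per0 : smooth_per (cst 0).
Proof.
split=> // s; rewrite (_ : iter_partial s _ = cst 0); last first.
  elim: s => //= i s ->; apply/funext => x; exact: derive_cst.
by split=> [|x i]; [exact: cst_continuous|exact: derivable_cst].
Qed.

Lemma sum_consE (T : Type) (I : Type) (k : I) (r : seq I) (F : I -> T -> R) :
  (fun x => \sum_(e <- k :: r) F e x) = lin 1 (F k) (fun x => \sum_(e <- r) F e x).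
Proof. by apply/funext => x; rewrite big_cons /lin mul1r. Qed.

Lemma sum_nilE (T : Type) (I : Type) (F : I -> T -> R) :
  (fun x => \sum_(e <- [::]) F e x) = cst 0.
Proof. by apply/funext => x; rewrite big_nil. Qed.

Lemma smooth_per_sum (I : Type) (r : seq I) (F : I -> 'rV[R]_d -> R) :
  (forall e, smooth_per (F e)) -> smooth_per (fun x => \sum_(e <- r) F e x).
Proof.
move=> sF; elim: r => [|k r IH]; first by rewrite sum_nilE; exact: smooth_per0.
by rewrite sum_consE; exact: smooth_per_lin.
Qed.

Lemma iter_partial_sum s (I : Type) (r : seq I) (F : I -> 'rV[R]_d -> R) :
  (forall e, smooth_per (F e)) ->
  iter_partial s (fun x => \sum_(e <- r) F e x) =
  (fun x => \sum_(e <- r) iter_partial s (F e) x).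
Proof.
move=> sF; elim: r => [|k r IH].
  rewrite !sum_nilE; elim: s => //= i s ->; apply/funext => x; exact: derive_cst.
have [? _] := smooth_per_sum r sF; have [? _] := sF k.
by rewrite !sum_consE iter_partial_lin// IH.
Qed.

Lemma smooth_per_laplacian v : smooth_per v -> smooth_per (classical_laplacian v).
Proof. by move=> sv; apply: smooth_per_sum => i; do 2 apply: smooth_per_partial. Qed.

Lemma L2_continuous v : continuous v -> L2 v.
Proof.
move=> cv; have mv := continuous_measurable_rV cv.
apply/andP; split; apply/mem_set => //=; rewrite /finite_norm unlock /Lnorm.
apply: poweR_lty.
under eq_integral => x _ do rewrite /= powR_mulrn//.
have c2 : continuous (fun x => `|v x| ^+ 2).
  move=> x; apply: (@continuous_comp _ _ _ v (fun y : R => `|y| ^+ 2)); first exact: cv.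
  by apply: (@continuous_comp _ _ _ (fun y : R => `|y|) (fun y : R => y ^+ 2));
    [exact: norm_continuous|exact: exprn_continuous].
rewrite integral_dx; last by apply/measurable_EFinP; exact: continuous_measurable_rV.
apply: integrable_lty; first exact: measurable_box.
exact: (integrable_box a b c2).
Qed.

Lemma L2_smooth v : smooth_per v -> L2 v.
Proof. by move=> [/smooth_continuous/L2_continuous]. Qed.

Lemma L2_iter s v : smooth_per v -> L2 (iter_partial s v).
Proof. by move=> [sv _]; exact: L2_continuous (smooth_continuous (smooth_iter s sv)). Qed.

Lemma inner_sum (I : Type) (r : seq I) (F : I -> 'rV[R]_d -> R) w :
  (forall e, L2 (F e)) -> L2 w ->
  inner (fun x => \sum_(e <- r) F e x) w = \sum_(e <- r) inner (F e) w.
Proof.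
move=> hF hw; suff [//] : L2 (fun x => \sum_(e <- r) F e x) /\
  inner (fun x => \sum_(e <- r) F e x) w = \sum_(e <- r) inner (F e) w.
elim: r => [|k r [hr IH]]; first by rewrite sum_nilE big_nil inner0l; split => //; exact: L2_0.
by rewrite sum_consE big_cons inner_linl// mul1r IH; split => //; exact: L2_lin.
Qed.

Hypothesis hab : forall i, a ord0 i < b ord0 i.

(** There is no boundary term: the integral of the derivative of the periodic
function u v over the box is zero. *)
Lemma integration_by_parts i u v : smooth_per u -> smooth_per v ->
  inner (partial i u) v = - inner u (partial i v).
Proof.
move=> hu hv; have [su pu] := hu; have [sv pv] := hv.
have Lu := L2_smooth hu; have Lv := L2_smooth hv.
have Ldu := L2_smooth (smooth_per_partial i hu).
have Ldv := L2_smooth (smooth_per_partial i hv).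
have du x := @smooth_derivable _ x i su; have dv x := @smooth_derivable _ x i sv.
have dE : partial i (u \* v) = (fun x => partial i u x * v x + u x * partial i v x).
  apply/funext => x; have := deriveM (du x) (dv x).
  by rewrite addrC [X in X + _]mulrC; apply.
have c0 : continuous (partial i (u \* v)).
  have cc w : smooth w -> continuous w := @smooth_continuous w.
  rewrite dE => x; apply: (cvgD (cvgM (cc _ (smooth_partial i su) x) (cc _ sv x))
    (cvgM (cc _ su x) (cc _ (smooth_partial i sv) x))).
apply/eqP; rewrite -subr_eq0 opprK -RintegralD//; [|exact: L2_integrable..].
rewrite -dE /Rintegral integral_dx; last first.
  by apply/measurable_EFinP; exact: continuous_measurable_rV.
have dM x : derivable (u \* v) x (basis_vec R i) by apply: derivableM.
have pM x : (u \* v) (x + (b ord0 i - a ord0 i) *: basis_vec R i) = (u \* v) x.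
  by rewrite /= pu pv.
by rewrite (integral_box_partial hab dM c0 pM).
Qed.

Lemma green_formula u v : smooth_per u -> smooth_per v ->
  inner (classical_laplacian u) v = - \sum_i inner (partial i u) (partial i v).
Proof.
move=> hu hv; rewrite inner_sum//; last exact: L2_smooth; last first.
  by move=> i; apply: L2_smooth; do 2 apply: smooth_per_partial.
rewrite -sumrN; apply: eq_bigr => i _.
by rewrite integration_by_parts//; exact: smooth_per_partial.
Qed.

Lemma classical_laplacian_sym u v : smooth_per u -> smooth_per v ->
  inner (classical_laplacian u) v = inner u (classical_laplacian v).
Proof.
move=> hu hv.
have flip : \sum_i inner (partial i u) (partial i v) =
    \sum_i inner (partial i v) (partial i u).
  apply: eq_bigr => i _; exact: innerC.
exact: etrans (etrans (green_formula hu hv) (congr1 -%R flip))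
  (esym (etrans (innerC a b u _) (green_formula hv hu))).
Qed.

Lemma classical_laplacian_le0 u : smooth_per u -> inner (classical_laplacian u) u <= 0.
Proof.
move=> hu; rewrite green_formula// oppr_le0; apply: sumr_ge0 => i _.
exact: sqnorm_ge0.
Qed.

End smooth_periodic.

(** * The strong Laplacian *)

Section laplacian.
Context (R : realType) (d : nat) (a b : 'rV[R]_d).
Hypothesis hab : forall i, a ord0 i < b ord0 i.
Implicit Types (u v w z : 'rV[R]_d -> R) (c : R) (i : 'I_d) (s : seq 'I_d).
Notation smooth_per := (smooth_per a b).
Notation L2 := (L2 a b).
Notation inner := (inner a b).
Notation L2cvg := (L2cvg a b).
Notation is_laplacian := (is_laplacian a b).
Notation Hper := (Hper a b).
Notation lap := (lap a b).
Notation dx := (dx a b).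

(** Both sides are limits along the approximating sequences, where they agree by
Green's formula. *)
Lemma is_laplacian_sym u w v z : L2 u -> L2 v ->
  is_laplacian u w -> is_laplacian v z -> inner w v = inner u z.
Proof.
move=> hu hv [hw [p [sp pu pw]]] [hz [q [sq qv qz]]].
have Lp j := L2_smooth (sp j); have Lq j := L2_smooth (sq j).
have Ldp j := L2_smooth (smooth_per_laplacian (sp j)).
have Ldq j := L2_smooth (smooth_per_laplacian (sq j)).
have cwv := inner_cvg Ldp Lq hw hv pw qv.
have cuz := inner_cvg Lp Ldq hu hz pu qz.
have E : (fun j => inner (classical_laplacian (p j)) (q j)) =
    (fun j => inner (p j) (classical_laplacian (q j))).
  by apply/funext => j; exact: classical_laplacian_sym.
by rewrite E in cwv; exact: (cvg_unique (@norm_hausdorff _ _) cwv cuz).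
Qed.

Lemma is_laplacian_le0 u w : L2 u -> is_laplacian u w -> inner w u <= 0.
Proof.
move=> hu [hw [p [sp pu pw]]].
have Lp j := L2_smooth (sp j).
have Ldp j := L2_smooth (smooth_per_laplacian (sp j)).
have cwu := inner_cvg Ldp Lp hw hu pw pu.
apply: (cvgr_to_le cwu).
by apply: nearW => j; exact: classical_laplacian_le0.
Qed.

Lemma classical_laplacian_lin c u v : smooth u -> smooth v ->
  classical_laplacian (lin c u v) = lin c (classical_laplacian u) (classical_laplacian v).
Proof.
move=> su sv; apply/funext => x; rewrite /classical_laplacian /lin mulr_sumr -big_split.
apply: eq_bigr => i _; rewrite (partial_lin i c su sv).
by rewrite (partial_lin i c (smooth_partial i su) (smooth_partial i sv)).
Qed.

Lemma is_laplacian_lin c u w v z : L2 u -> L2 v ->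
  is_laplacian u w -> is_laplacian v z -> is_laplacian (lin c u v) (lin c w z).
Proof.
move=> hu hv [hw [p [sp pu pw]]] [hz [q [sq qv qz]]].
split; first exact: L2_lin.
have Lp j := L2_smooth (sp j); have Lq j := L2_smooth (sq j).
have Ldp j := L2_smooth (smooth_per_laplacian (sp j)).
have Ldq j := L2_smooth (smooth_per_laplacian (sq j)).
exists (fun j => lin c (p j) (q j)); split.
- by move=> j; exact: smooth_per_lin.
- exact: (L2cvg_lin c Lp Lq hu hv pu qv).
- have E : (fun j => classical_laplacian (lin c (p j) (q j))) =
      (fun j => lin c (classical_laplacian (p j)) (classical_laplacian (q j))).
    by apply/funext => j; exact: classical_laplacian_lin (sp j).1 (sq j).1.
  by rewrite E; exact: (L2cvg_lin c Ldp Ldq hw hz pw qz).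
Qed.

Lemma is_laplacian_smooth v : smooth_per v -> is_laplacian v (classical_laplacian v).
Proof.
move=> sv; split; first by apply: L2_smooth; exact: smooth_per_laplacian.
by exists (fun=> v); split => //; exact: L2cvg_cst.
Qed.

(** By linearity it suffices that a Laplacian z of 0 vanishes.  By symmetry
(z, f) = (0, Delta f) = 0 for f smooth and periodic; z is itself an L^2 limit
of such functions, namely of the Laplacians of the approximations of 0, so
(z, z) = 0. *)
Lemma is_laplacian_unique u w z : L2 u ->
  is_laplacian u w -> is_laplacian u z -> w = z %[ae dx].
Proof.
move=> hu uw uz; have [hw _] := uw; have [hz _] := uz.
have := is_laplacian_lin (-1) hu hu uz uw.
rewrite -!linN1E (_ : u \- u = cst 0); last by apply/funext => x /=; rewrite subrr.
move=> H; have [h0 [p [sp _ pz]]] := H.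
suff /(inner_eq0_ae h0) : inner (w \- z) (w \- z) = 0.
  by apply: filterS => x /= h _; apply/eqP; rewrite -subr_eq0 h.
have sl j : smooth_per (classical_laplacian (p j)) by exact: smooth_per_laplacian.
have Ldp j := L2_smooth (sl j).
have c0 := inner_cvg Ldp (fun=> h0) h0 h0 pz (L2cvg_cst a b _).
have E : (fun j => inner (classical_laplacian (p j)) (w \- z)) = cst 0.
  apply/funext => j; rewrite innerC.
  rewrite (is_laplacian_sym (L2_0 a b) (Ldp j) H (is_laplacian_smooth (sl j))).
  exact: inner0l.
rewrite E in c0; exact: (cvg_unique (@norm_hausdorff _ _) c0 (cvg_cst _)).
Qed.

Lemma lapP u w : is_laplacian u w -> is_laplacian u (lap u).
Proof.
move=> uw; exact: (@xgetPex _ (cst 0) [set w | is_laplacian u w] (ex_intro _ w uw)).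
Qed.

Lemma L2_lap u : L2 (lap u).
Proof.
by rewrite /Defs.lap; case: xgetP => [w _ [hw _]//|_]; exact: L2_0.
Qed.

Lemma lapE u w : L2 u -> is_laplacian u w -> lap u = w %[ae dx].
Proof. by move=> hu uw; apply: is_laplacian_unique hu (lapP uw) uw. Qed.

Lemma lap_lin c u v : L2 u -> L2 v -> is_laplacian u (lap u) -> is_laplacian v (lap v) ->
  lap (lin c u v) = lin c (lap u) (lap v) %[ae dx].
Proof. by move=> hu hv lu lv; apply: lapE; [exact: L2_lin|exact: is_laplacian_lin]. Qed.

Lemma Hper_L2 k u : Hper k u -> L2 u.
Proof. by case. Qed.

Lemma Hper_lin k c u v : Hper k u -> Hper k v -> Hper k (lin c u v).
Proof.
move=> [hu [p [sp pu pd]]] [hv [q [sq qv qd]]]; split; first exact: L2_lin.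
exists (fun j => lin c (p j) (q j)); split.
- by move=> j; exact: smooth_per_lin.
- exact: (L2cvg_lin c (fun j => L2_smooth (sp j)) (fun j => L2_smooth (sq j)) hu hv pu qv).
- move=> s sk; have [w hw pw] := pd s sk; have [z hz qz] := qd s sk.
  exists (lin c w z); first exact: L2_lin.
  have E : (fun j => iter_partial s (lin c (p j) (q j))) =
      (fun j => lin c (iter_partial s (p j)) (iter_partial s (q j))).
    by apply/funext => j; exact: (iter_partial_lin s c (sp j).1 (sq j).1).
  rewrite E.
  exact: (L2cvg_lin c (fun j => L2_iter s (sp j)) (fun j => L2_iter s (sq j)) hw hz pw qz).
Qed.

Lemma Hper_ae k u v : L2 v -> u = v %[ae dx] -> Hper k u -> Hper k v.
Proof.
move=> hv uv [hu [p [sp pu pd]]]; split=> //; exists p; split=> //.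
by apply: L2cvg_ae pu => // j; exact: L2_smooth.
Qed.

Lemma L2cvg_sum (I : Type) (r : seq I) (p : I -> nat -> 'rV[R]_d -> R)
    (w : I -> 'rV[R]_d -> R) :
  (forall e j, L2 (p e j)) -> (forall e, L2 (w e)) -> (forall e, L2cvg (p e) (w e)) ->
  L2 (fun x => \sum_(e <- r) w e x) /\
  L2cvg (fun j x => \sum_(e <- r) p e j x) (fun x => \sum_(e <- r) w e x).
Proof.
move=> hp hw pw.
suff [_ //] : (forall j, L2 (fun x => \sum_(e <- r) p e j x)) /\
  L2 (fun x => \sum_(e <- r) w e x) /\
  L2cvg (fun j x => \sum_(e <- r) p e j x) (fun x => \sum_(e <- r) w e x).
elim: r => [|k r [IH1 [IH2 IH3]]].
  rewrite sum_nilE (_ : (fun j x => _) = fun=> cst 0); last first.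
    by apply/funext => j; rewrite (sum_nilE (p ^~ j)).
  split; first by move=> j; rewrite (sum_nilE (p ^~ j)); exact: L2_0.
  by split; [exact: L2_0|exact: L2cvg_cst].
have E : (fun j x => \sum_(e <- k :: r) p e j x) =
    (fun j => lin 1 (p k j) (fun x => \sum_(e <- r) p e j x)).
  by apply/funext => j; rewrite (sum_consE k r (p ^~ j)).
split; first by move=> j; rewrite (sum_consE k r (p ^~ j)); exact: L2_lin.
by rewrite sum_consE E; split; [exact: L2_lin|exact: L2cvg_lin].
Qed.

(** The sequence that approximates u in H^(k+2) also produces its Laplacian, and
its Laplacians approximate lap u in H^k, because the derivatives of order s of
Delta v are sums of derivatives of order s + 2 of v. *)
Lemma Hper_lap k u : Hper k.+2 u -> is_laplacian u (lap u) /\ Hper k (lap u).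
Proof.
move=> [hu [p [sp pu pd]]].
have sp2 j i : smooth_per (partial i (partial i (p j))) by do 2 apply: smooth_per_partial.
have sl j : smooth_per (classical_laplacian (p j)) by exact: smooth_per_laplacian.
have iterE s j : iter_partial s (classical_laplacian (p j)) =
    (fun x => \sum_i iter_partial (s ++ [:: i; i]) (p j) x).
  rewrite (iter_partial_sum s _ (sp2 j)); apply/funext => x; apply: eq_bigr => i _.
  by rewrite /iter_partial foldr_cat.
have L s j := L2_iter s (sp j).
have cvg s : (size s <= k)%N -> exists2 w, L2 w &
    L2cvg (fun j => iter_partial s (classical_laplacian (p j))) w.
  move=> sk; have /choice[w hw] : forall i, exists w, L2 w /\
      L2cvg (fun j => iter_partial (s ++ [:: i; i]) (p j)) w.
    move=> i; have [|w] := pd (s ++ [:: i; i]); last by exists w.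
    by rewrite size_cat addn2.
  have [Lw cw] := L2cvg_sum (index_enum 'I_d) (fun i j => L (s ++ [:: i; i]) j)
    (fun i => (hw i).1) (fun i => (hw i).2).
  have E : (fun j => iter_partial s (classical_laplacian (p j))) =
      (fun j x => \sum_i iter_partial (s ++ [:: i; i]) (p j) x).
    by apply/funext => j; exact: iterE.
  by exists (fun x => \sum_i w i x); rewrite ?E.
have [//|w hw pw] := cvg [::].
have uw : is_laplacian u w by split=> //; exists p; split.
split; first exact: lapP uw.
apply: (@Hper_ae _ w); first exact: L2_lap.
  by apply: filterS (lapE hu uw) => x /= h ?; rewrite h.
by split=> //; exists (fun j => classical_laplacian (p j)); split.
Qed.

End laplacian.

(** * The threshold on the step ratios *)

Lemma powR_3_2 (R : realType) (z : R) : 0 <= z -> z `^ (3 / 2) = Num.sqrt z ^+ 3.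
Proof.
by move=> z0; rewrite (mulrC 3) powRrM powR12_sqrt// powR_mulrn// sqrtr_ge0.
Qed.

Lemma G_sqrtE (R : realType) (sigma s z : R) : 0 < s -> 0 < z ->
  G sigma s z =
  (2 + 4 * sigma * Num.sqrt s ^+ 2 - (2 * sigma - 1) * Num.sqrt s ^+ 3) / (1 + Num.sqrt s ^+ 2)
  - (2 * sigma - 1) * Num.sqrt z ^+ 3 / (1 + Num.sqrt z ^+ 2).
Proof. by move=> s0 z0; rewrite /G !powR_3_2 ?ltW// !sqr_sqrtr ?ltW. Qed.

(** Here y, w and Y are the square roots of the two ratios and of the threshold,
and the equation for Y is G(Y^2, Y^2) = 0.  The right side dominates, and the
left side is dominated by, their common value K at w = y = Y: the left side
increases with w, and the right side is at least K when a cubic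
(2 - K) + (2 + 4 sigma - K) y^2 - (2 sigma - 1) y^3 vanishing at Y is
nonnegative, which holds since 2 - K >= 0 makes its quotient by y^2
decreasing.  The displayed identity is this monotonicity with the denominators
cleared. *)
Lemma cubic_threshold (R : realFieldType) (sigma y w Y : R) :
  2^-1 <= sigma <= 1 -> 0 < y <= Y -> 0 < w <= Y ->
  1 + 2 * sigma * Y ^+ 2 = (2 * sigma - 1) * Y ^+ 3 ->
  (2 * sigma - 1) * w ^+ 3 / (1 + w ^+ 2) <=
  (2 + 4 * sigma * y ^+ 2 - (2 * sigma - 1) * y ^+ 3) / (1 + y ^+ 2).
Proof.
move=> /andP[s1 s2] /andP[y0 yY] /andP[w0 wY] root.
have Y0 : 0 < Y := lt_le_trans y0 yY.
have k0 : 0 <= 2 * sigma - 1 by lra.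
have pos x : 0 < 1 + x ^+ 2 :> R by rewrite ltr_wpDr ?sqr_ge0.
apply: (@le_trans _ _ ((2 * sigma - 1) * Y ^+ 3 / (1 + Y ^+ 2))).
  rewrite ler_pdivrMr ?pos// [leRHS]mulrAC ler_pdivlMr ?pos// -!mulrA ler_wpM2l//.
  have w3 : w ^+ 3 <= Y ^+ 3 by rewrite lerXn2r// nnegrE ltW.
  have : w ^+ 2 * Y ^+ 2 * w <= w ^+ 2 * Y ^+ 2 * Y by rewrite ler_wpM2l// mulr_ge0 ?sqr_ge0.
  by rewrite !mulrDr !mulr1 => h; rewrite (lerD w3)//; move: h; congr (_ <= _); ring.
rewrite -root ler_pdivrMr ?pos// [leRHS]mulrAC ler_pdivlMr ?pos//.
rewrite -(ler_pM2l (exprn_gt0 2 Y0)) -subr_ge0.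
have -> : Y ^+ 2 * ((2 + 4 * sigma * y ^+ 2 - (2 * sigma - 1) * y ^+ 3) * (1 + Y ^+ 2)) -
    Y ^+ 2 * ((1 + 2 * sigma * Y ^+ 2) * (1 + y ^+ 2)) =
    (1 + 2 * (1 - sigma) * Y ^+ 2) * ((Y - y) * (Y + y)) +
    (2 * sigma - 1) * (y ^+ 2 * Y ^+ 2 * (1 + Y ^+ 2)) * (Y - y)
    + (1 + 2 * sigma * Y ^+ 2 - (2 * sigma - 1) * Y ^+ 3) * (y ^+ 2 * (1 + Y ^+ 2)).
  ring.
rewrite root subrr mul0r addr0.
have Yy : 0 <= Y - y by rewrite subr_ge0.
apply: addr_ge0.
  apply: mulr_ge0; last by rewrite mulr_ge0// addr_ge0// ltW.
  by rewrite addr_ge0// mulr_ge0 ?sqr_ge0//; lra.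
apply: mulr_ge0 => //; apply: mulr_ge0 => //.
by rewrite !mulr_ge0 ?sqr_ge0// ltW// pos.
Qed.

(** For sigma > 1/2 the threshold is either a positive root of G(z, z) = 0, where
[cubic_threshold] applies, or the default value 0, below which there is no
positive ratio. *)
Lemma G_ge0 (R : realType) (sigma s z : R) : 2^-1 <= sigma <= 1 ->
  0 < s -> (s%:E <= gamma_starstar sigma)%E ->
  0 < z -> (z%:E <= gamma_starstar sigma)%E -> 0 <= G sigma s z.
Proof.
move=> hs s0 + z0; rewrite /gamma_starstar.
have [sh _ _|sh] := eqVneq sigma 2^-1.
  have k0 : 2 * sigma - 1 = 0 by rewrite sh; lra.
  rewrite /G k0 !mul0r subr0 subr0 divr_ge0//; last by rewrite addr_ge0// ltW.
  by rewrite addr_ge0// !mulr_ge0// ?ltW// sh; lra.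
case: xgetP => [g _ [g0 Gg]|_]; last by rewrite lee_fin leNgt s0.
rewrite !lee_fin => sg zg; move: Gg; rewrite !G_sqrtE// -mulrBl.
set Y := Num.sqrt g; set y := Num.sqrt s; set w := Num.sqrt z => Gg.
have Y0 : 0 < Y by rewrite sqrtr_gt0.
rewrite subr_ge0; apply: (@cubic_threshold _ sigma y w Y) => //.
- by rewrite sqrtr_gt0 s0 ler_sqrt// ltW.
- by rewrite sqrtr_gt0 z0 ler_sqrt// ltW.
- move/eqP: Gg; rewrite mulf_eq0 invr_eq0 (gt_eqF (ltr_wpDr (sqr_ge0 _) ltr01)) orbF => /eqP.
  by move=> h; lra.
Qed.

(** * The inverse Laplacian *)

Section inverse_laplacian.
Context (R : realType) (d : nat) (a b : 'rV[R]_d).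
Hypothesis hab : forall i, a ord0 i < b ord0 i.
Implicit Types (u v w z : 'rV[R]_d -> R) (c : R).
Notation L2 := (L2 a b).
Notation inner := (inner a b).
Notation sqnorm := (sqnorm a b).
Notation is_laplacian := (is_laplacian a b).
Notation Hper := (Hper a b).
Notation lap := (lap a b).
Notation dx := (dx a b).
Notation is_inv_neg_laplacian := (is_inv_neg_laplacian a b).

Lemma Hper_is_laplacian k u : Hper k.+2 u -> is_laplacian u (lap u).
Proof. by case/(Hper_lap hab). Qed.

Lemma inner_inv_neg_laplacian u psi w : L2 u -> L2 w -> is_inv_neg_laplacian u psi ->
  inner (lap psi) w = - inner u w.
Proof.
move=> hu hw [hpsi psiu _].
have E : lin (-1) (lap psi) (cst 0) = \- lap psi.
  by apply/funext => x; rewrite /lin /= addr0 mulN1r.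
have hl := L2_lap a b psi; have h0 := L2_0 a b.
have := inner_ae (L2_lin (-1) hl h0) hu hw.
rewrite E => /(_ psiu) <-; rewrite -E inner_linl// inner0l.
by rewrite addr0 mulN1r opprK.
Qed.

Lemma inv_neg_laplacian_sym u psi v chi : L2 u -> L2 v ->
  is_inv_neg_laplacian u psi -> is_inv_neg_laplacian v chi ->
  inner psi v = inner chi u.
Proof.
move=> hu hv hp hc; have [Hp _ _] := hp; have [Hc _ _] := hc.
apply: oppr_inj; rewrite innerC -(inner_inv_neg_laplacian hv (Hper_L2 Hp) hc).
rewrite [inner chi u]innerC -(inner_inv_neg_laplacian hu (Hper_L2 Hc) hp) innerC.
exact/esym/(is_laplacian_sym hab (Hper_L2 Hp) (Hper_L2 Hc)
  (Hper_is_laplacian Hp) (Hper_is_laplacian Hc)).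
Qed.

(** This is the nonnegativity of (-Delta f, f) at f = psi - c chi. *)
Lemma inv_neg_laplacian_young c u psi v chi : L2 u -> L2 v ->
  is_inv_neg_laplacian u psi -> is_inv_neg_laplacian v chi ->
  2 * c * inner psi v <= inner psi u + c ^+ 2 * inner chi v.
Proof.
move=> hu hv hp hc; have sym := inv_neg_laplacian_sym hu hv hp hc.
have [Hp _ _] := hp; have [Hc _ _] := hc.
have Lp := Hper_L2 Hp; have Lc := Hper_L2 Hc.
have llp := L2_lap a b psi; have llc := L2_lap a b chi.
have := is_laplacian_le0 hab (L2_lin (- c) Lc Lp)
  (is_laplacian_lin (- c) Lc Lp (Hper_is_laplacian Hc) (Hper_is_laplacian Hp)).
rewrite inner_linl//; last exact: L2_lin.
rewrite !inner_linr//.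
rewrite !(inner_inv_neg_laplacian hu _ hp)// !(inner_inv_neg_laplacian hv _ hc)//.
rewrite -!(innerC a b chi) -!(innerC a b psi) sym => h.
lra.
Qed.

Lemma inv_neg_laplacian_ge0 u psi :
  L2 u -> is_inv_neg_laplacian u psi -> 0 <= inner psi u.
Proof.
move=> hu hp; have := inv_neg_laplacian_young 0 hu hu hp hp.
by rewrite expr0n/= mulr0 !mul0r addr0.
Qed.

(** * The discrete energy *)

(** The function f, a cubic of an L^2 function in the application, is not known
to be square integrable by itself; since c is nonzero it equals (m - g) / c
almost everywhere, which is. *)
Lemma inner_ae_affine (f m g w : 'rV[R]_d -> R) c :
  measurable_fun [set: 'rV[R]_d] f -> L2 m -> L2 g -> L2 w ->
  m = (fun x => g x + c * f x) %[ae dx] ->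
  c != 0 -> dx.-integrable [set: 'rV[R]_d] (EFin \o (fun x => f x * w x)) /\
  inner m w = inner g w + c * \int[dx]_x (f x * w x).
Proof.
move=> mf hm hg hw mE c0.
pose h := lin c^-1 m (lin (- c^-1) g (cst 0)).
have hh : L2 h by do 2 apply: L2_lin => //; exact: L2_0.
have fh : ae_eq dx setT (EFin \o (fun x => (h x * w x)%R))
    (EFin \o (fun x => (f x * w x)%R)).
  apply: filterS mE => x /= mx _; rewrite /h /lin /= mx//; congr EFin; field.
  exact: c0.
have ih := L2_integrable hh hw.
have mfw : measurable_fun [set: 'rV[R]_d] (EFin \o (fun x => (f x * w x)%R)).
  by apply/measurable_EFinP/measurable_funM => //; exact: L2_measurable hw.
have mhw := measurable_int _ ih.
split.
  apply/integrableP; split=> //; have /integrableP[_] := ih.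
  apply: le_lt_trans; rewrite le_eqVlt; apply/orP; left; apply/eqP.
  apply: ae_eq_integral => //; [exact: measurableT_comp|exact: measurableT_comp|].
  by apply: filterS fh => x /= + xT => /(_ xT) [->].
have -> : \int[dx]_x (f x * w x) = inner h w.
  by congr fine; apply/esym; exact: ae_eq_integral.
rewrite /h inner_linl//; last by apply: L2_lin => //; exact: L2_0.
rewrite inner_linl//; last exact: L2_0.
by rewrite inner0l; field.
Qed.

(** With z = v - u the difference of the two sides is
(sigma - 1/2) |z|^2. *)
Lemma sqnorm_sigma_le sigma u v w z : 2^-1 <= sigma -> L2 u -> L2 v -> L2 w -> L2 z ->
  v = lin 1 z u %[ae dx] -> w = lin sigma z u %[ae dx] ->
  2^-1 * sqnorm v - 2^-1 * sqnorm u <= inner w z.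
Proof.
move=> s hu hv hw hz vE wE.
have hv' := L2_lin 1 hz hu; have hw' := L2_lin sigma hz hu.
rewrite (inner_ae hw hw' hz wE) /Defs.sqnorm.
rewrite (inner_ae hv hv' hv vE) innerC (inner_ae hv hv' hv' vE).
rewrite !(inner_linl, inner_linr)// (innerC a b u z).
have := sqnorm_ge0 a b z => z0.
have : 0 <= (sigma - 2^-1) * inner z z by rewrite mulr_ge0// subr_ge0.
lra.
Qed.

End inverse_laplacian.

Lemma Fnl_derive1 (R : realType) (S eps : R) :
  derive1 (Fnl eps S) = (fun p => p ^+ 3 - (S + eps) * p).
Proof.
apply/funext => p; rewrite derive1E.
have h4 : is_derive p (1 : R) (fun q : R => q ^+ 4) (4 * p ^+ 3).
  by apply: DeriveDef; [exact: exprn_derivable|rewrite exp_derive /GRing.scale /= mulr1].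
have h2 : is_derive p (1 : R) (fun q : R => q ^+ 2) (2 * p).
  by apply: DeriveDef; [exact: exprn_derivable|rewrite exp_derive /GRing.scale /= mulr1 expr1].
have h : is_derive p (1 : R) (Fnl eps S) (4^-1 * (4 * p ^+ 3) - (S + eps) / 2 * (2 * p)).
  exact: is_deriveB (is_deriveZ 4^-1 h4) (is_deriveZ ((S + eps) / 2) h2).
rewrite (@derive_val _ _ _ _ _ _ _ h); by field.
Qed.

Section energy_step.
Context (R : realType) (d : nat) (a b : 'rV[R]_d).
Hypothesis hab : forall i, a ord0 i < b ord0 i.
Context (beta S sigma : R).
Implicit Types (u v w z : 'rV[R]_d -> R) (c : R).
Notation L2 := (L2 a b).
Notation inner := (inner a b).
Notation sqnorm := (sqnorm a b).
Notation Hper := (Hper a b).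
Notation lap := (lap a b).
Notation dx := (dx a b).
Notation lap_beta := (lap_beta a b beta).

Lemma lap_betaE u : lap_beta u = lin beta u (lap u).
Proof. by apply/funext => x; rewrite /Defs.lap_beta /lin addrC. Qed.

Lemma L2_lap_beta u : L2 u -> L2 (lap_beta u).
Proof. by move=> hu; rewrite lap_betaE; apply: L2_lin => //; exact: L2_lap. Qed.

Lemma lap_beta_lin c u v : Hper 4 u -> Hper 4 v ->
  lap_beta (lin c u v) = lin c (lap_beta u) (lap_beta v) %[ae dx].
Proof.
move=> hu hv; have := lap_lin hab c (Hper_L2 hu) (Hper_L2 hv)
  (Hper_is_laplacian hab hu) (Hper_is_laplacian hab hv).
apply: filterS => x e xT; rewrite /Defs.lap_beta (e xT) /lin; ring.
Qed.

Lemma lap_beta_sqE u : lap_beta_sq a b beta u =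
  lin 1 (lap (lap u)) (lin (2 * beta) (lap u) (lin (beta ^+ 2) u (cst 0))).
Proof. by apply/funext => x; rewrite /Defs.lap_beta_sq /lin /=; ring. Qed.

Lemma L2_lap_beta_sq u : L2 u -> L2 (lap_beta_sq a b beta u).
Proof.
move=> hu; rewrite lap_beta_sqE.
by do 3 (apply: L2_lin; [by [|exact: L2_lap]|]); exact: L2_0.
Qed.

Lemma inner_lap_beta_sq u v : Hper 4 u -> Hper 4 v ->
  inner (lap_beta_sq a b beta u) v = inner (lap_beta u) (lap_beta v).
Proof.
move=> hu hv.
have Lu := Hper_L2 hu; have Lv := Hper_L2 hv; have L0 := L2_0 a b.
have Llu := L2_lap a b u; have Llv := L2_lap a b v; have Lllu := L2_lap a b (lap u).
have [lu hlu] := Hper_lap hab hu; have [lv hlv] := Hper_lap hab hv.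
have [llu _] := Hper_lap hab hlu.
rewrite !lap_betaE lap_beta_sqE.
have L1 := L2_lin (beta ^+ 2) Lu L0; have L3 := L2_lin (2 * beta) Llu L1.
have L4 := L2_lin beta Lv Llv.
rewrite !inner_linl// inner0l !inner_linr//.
(* (Delta^2 u, v) = (Delta u, Delta v), and beta (u, Delta v) = beta (Delta u, v)
   doubles the other cross term *)
rewrite (is_laplacian_sym hab Llu Lv llu lv) -(is_laplacian_sym hab Lu Lv lu lv).
ring.
Qed.

(** The two quadratic terms of the energy are instances of [sqnorm_sigma_le], for
the functions themselves and for their images under Delta + beta. *)
Lemma energy_step_le p1 p2 u : 2^-1 <= sigma -> 0 <= S ->
  Hper 4 p1 -> Hper 4 p2 -> u = lin sigma (p2 \- p1) p1 ->
  2^-1 * sqnorm (lap_beta p2) + S / 2 * sqnorm p2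
    - (2^-1 * sqnorm (lap_beta p1) + S / 2 * sqnorm p1) <=
  inner (lin S u (lap_beta_sq a b beta u)) (p2 \- p1).
Proof.
move=> hs hS h1 h2 uE.
have hD : Hper 4 (p2 \- p1) by rewrite linN1E; exact: Hper_lin.
have hU : Hper 4 u by rewrite uE; exact: Hper_lin.
have p2E : p2 = lin 1 (p2 \- p1) p1.
  by apply/funext => x; rewrite /lin /= mul1r subrK.
have LU := Hper_L2 hU; have LD := Hper_L2 hD; have L1 := Hper_L2 h1; have L2p := Hper_L2 h2.
rewrite (inner_linl S LU (L2_lap_beta_sq LU) LD) inner_lap_beta_sq//.
have e1 : 2^-1 * sqnorm p2 - 2^-1 * sqnorm p1 <= inner u (p2 \- p1).
  apply: (sqnorm_sigma_le hs L1 L2p LU LD).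
    by apply: nearW => x _; rewrite {1}p2E.
  by apply: nearW => x _; rewrite uE.
have e2 : 2^-1 * sqnorm (lap_beta p2) - 2^-1 * sqnorm (lap_beta p1) <=
    inner (lap_beta u) (lap_beta (p2 \- p1)).
  apply: (sqnorm_sigma_le hs (L2_lap_beta L1) (L2_lap_beta L2p) (L2_lap_beta LU)
    (L2_lap_beta LD)).
    by have := lap_beta_lin 1 hD h1; rewrite -p2E.
  by have := lap_beta_lin sigma hD h1; rewrite -uE.
have := ler_wpM2l hS e1; lra.
Qed.

End energy_step.

(** The difference of the two sides is a nonnegative combination of
G(gamma, gamma') and of the Young inequality between A = (D, D)_(-1),
B = (D', D')_(-1) and X = (D', D)_(-1), as is seen after replacing gamma by
y^2 and tau' by y^2 tau. *)
Lemma G_young_le (R : realType) (sigma g g' ta ta' A B X : R) :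
  0 <= 2 * sigma - 1 -> 0 < g -> 0 < g' -> 0 < ta -> g = ta' / ta ->
  0 <= A -> 2 * Num.sqrt g * X <= A + Num.sqrt g ^+ 2 * B -> 0 <= G sigma g g' ->
  (2 * sigma - 1) * g' `^ (3 / 2) / (2 + 2 * g') * (A / ta')
    - (2 * sigma - 1) * g `^ (3 / 2) / (2 + 2 * g) * (B / ta) <=
  ta'^-1 * ((1 + 2 * sigma * g) / (1 + g) * A
            - (2 * sigma - 1) * g ^+ 2 / (1 + g) * X).
Proof.
move=> k0 g0 g'0 ta0 gE A0.
have ta'E : ta' = g * ta by rewrite gE mulfVK// gt_eqF.
have root (x : R) : 0 < x -> exists2 y, 0 < y & x = y ^+ 2.
  by move=> x0; exists (Num.sqrt x); rewrite ?sqrtr_gt0 ?sqr_sqrtr ?ltW.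
have rootK (x y : R) : 0 < y -> x = y ^+ 2 -> Num.sqrt x = y.
  by move=> y0 ->; rewrite sqrtr_sqr gtr0_norm.
have [y y0 gy] := root _ g0; have [w w0 gw] := root _ g'0.
rewrite G_sqrtE// (powR_3_2 (ltW g0)) (powR_3_2 (ltW g'0)).
rewrite (rootK _ _ y0 gy) (rootK _ _ w0 gw) ta'E gy gw => young G0.
have ypos : 0 < 1 + y ^+ 2 by rewrite ltr_wpDr ?sqr_ge0.
have wpos : 0 < 1 + w ^+ 2 by rewrite ltr_wpDr ?sqr_ge0.
rewrite -subr_ge0.
set q := (2 * sigma - 1) * y / (2 * (1 + y ^+ 2) * ta).
have q0 : 0 <= q by rewrite divr_ge0// mulr_ge0// ltW// mulr_gt0.
have A0' : 0 <= 2^-1 * (A / (y ^+ 2 * ta)).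
  by rewrite mulr_ge0// divr_ge0// ltW// mulr_gt0// exprn_gt0.
have young0 : 0 <= A + y ^+ 2 * B - 2 * y * X by rewrite subr_ge0.
have := addr_ge0 (mulr_ge0 A0' G0) (mulr_ge0 q0 young0).
congr (0 <= _); rewrite /q; field.
have two x : 0 < 1 + x ^+ 2 -> 2 + 2 * x ^+ 2 != 0 :> R.
  by move=> h; rewrite gt_eqF//; lra.
by rewrite (two _ ypos) (two _ wpos) !gt_eqF.
Qed.

Section scheme.
Context (R : realType) (d : nat) (a b : 'rV[R]_d).
Hypothesis hab : forall i, a ord0 i < b ord0 i.
Implicit Types (u v w z : 'rV[R]_d -> R).
Notation L2 := (L2 a b).
Notation inner := (inner a b).
Notation Hper := (Hper a b).
Notation lap := (lap a b).
Notation dx := (dx a b).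

Lemma inner_lap_inv_neg_laplacian (F m D psi : 'rV[R]_d -> R) :
  L2 F -> Hper 2 m -> L2 D -> F = lap m %[ae dx] -> is_inv_neg_laplacian a b D psi ->
  inner F psi = - inner m D.
Proof.
move=> hF hm hD FE hp; have [Hp _ _] := hp.
have Lp := Hper_L2 Hp; have Lm := Hper_L2 hm.
rewrite (inner_ae hF (L2_lap a b m) Lp FE).
rewrite (is_laplacian_sym hab Lm Lp (Hper_is_laplacian hab hm) (Hper_is_laplacian hab Hp)).
by rewrite innerC (inner_inv_neg_laplacian hD Lm hp) innerC.
Qed.

Lemma F2_incrementsE sigma (t gamma : nat -> R) (phi : nat -> 'rV[R]_d -> R) n :
  gamma n.+1 != -1 ->
  F2 sigma t gamma phi n =
  lin ((tau t n.+1)^-1 * ((1 + 2 * sigma * gamma n.+1) / (1 + gamma n.+1)))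
    (phi n.+1 \- phi n)
    (lin (- ((tau t n.+1)^-1 * ((2 * sigma - 1) * gamma n.+1 ^+ 2 / (1 + gamma n.+1))))
      (phi n \- phi n.-1) (cst 0)).
Proof.
move=> g1; apply/funext => x; rewrite /F2 /lin /= addr0.
have : 1 + gamma n.+1 != 0 by apply: contra g1; rewrite addrC addr_eq0.
move: (gamma n.+1) (tau t n.+1)^-1 => g ti g0.
by field.
Qed.

(** The nonlinear term of (mu, D) is r' I / q, where I is the integral of
F'(phi_star) D and q = sqrt (E_1 + C_0), while the equation for r says
r' - r = I / (2 q).  The integrability of F'(phi_star) D is read off from the
equation for mu when r' is nonzero; when r' = 0 both contributions vanish
whatever the value of I. *)
Lemma inner_scheme_mu beta eps S C0 sigma (t gamma r : nat -> R)
    (phi mu : nat -> 'rV[R]_d -> R) n :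
  0 < tau t n.+1 -> 0 < E1 a b eps S (phi n) + C0 ->
  L2 (phi n.-1) -> L2 (phi n) -> L2 (phi n.+1) -> L2 (mu n) ->
  scheme_step a b beta eps S C0 sigma t gamma phi mu r n ->
  inner (mu n) (phi n.+1 \- phi n) =
  inner (lin S (phi_sigma sigma phi n) (lap_beta_sq a b beta (phi_sigma sigma phi n)))
    (phi n.+1 \- phi n) + 2 * r n.+1 * (r n.+1 - r n).
Proof.
move=> t0 E0 h0 h1 h2 hm [_ muE rE].
have q0 : 0 < Num.sqrt (E1 a b eps S (phi n) + C0) by rewrite sqrtr_gt0.
move: (Num.sqrt _) q0 muE rE => q q0 muE rE.
have hD : L2 (phi n.+1 \- phi n) by exact: L2B.
have hU : L2 (phi_sigma sigma phi n).
  rewrite (_ : phi_sigma _ _ _ = lin sigma (phi n.+1 \- phi n) (phi n)); first exact: L2_lin.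
  by apply/funext => x; rewrite /phi_sigma /lin /=; ring.
have hg := L2_lin S hU (L2_lap_beta_sq beta hU).
have hS : L2 (phi_star sigma gamma phi n).
  rewrite (_ : phi_star _ _ _ _ = lin (sigma * gamma n.+1) (phi n \- phi n.-1) (phi n)).
    by apply: L2_lin => //; exact: L2B.
  by apply/funext => x; rewrite /phi_star /lin /=; ring.
pose f x := derive1 (Fnl eps S) (phi_star sigma gamma phi n x).
have mf : measurable_fun [set: 'rV[R]_d] f.
  rewrite /f Fnl_derive1; have mS := L2_measurable hS.
  apply: measurable_funB; first exact: measurable_funX.
  exact: measurable_funM.
have {}muE : mu n = (fun x => lin S (phi_sigma sigma phi n)
    (lap_beta_sq a b beta (phi_sigma sigma phi n)) x + r n.+1 / q * f x) %[ae dx].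
  apply: filterS muE => x e xT; rewrite (e xT) /lin /f; ring.
have [r0|r0] := eqVneq (r n.+1) 0.
  rewrite r0 mulr0 mul0r addr0; apply: inner_ae => //.
  by apply: filterS muE => x e xT; rewrite (e xT) r0 !mul0r addr0.
have c0 : r n.+1 / q != 0 by rewrite mulf_neq0// invr_neq0// gt_eqF.
have [ifD ->] := inner_ae_affine mf hm hg hD muE c0.
congr (_ + _); move: rE.
under eq_Rintegral do rewrite mulrA.
rewrite RintegralZr// => rE.
have -> : r n.+1 - r n = (2 * q)^-1 * \int[dx]_x (f x * (phi n.+1 \- phi n) x).
  move/(congr1 ( *%R^~ (tau t n.+1))): rE; rewrite mulfVK ?gt_eqF// => ->.
  by rewrite -mulrA mulfVK ?gt_eqF.
by field; rewrite gt_eqF.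
Qed.

End scheme.

Theorem theorem2p1 (R : realType) (d : nat) (hd : d = 2%N \/ d = 3%N)
    (a b : 'rV[R]_d) (hab : forall i, a ord0 i < b ord0 i)
    (beta eps S C0 sigma : R)
    (hbeta : 0 < beta) (heps : 0 < eps < beta ^+ 2) (hS : 0 <= S)
    (hC0 : 0 < C0) (hsigma : 2^-1 <= sigma <= 1)
    (M : nat) (T : R) (t gamma : nat -> R) (ht : mesh M T t)
    (hgamma : forall n, (1 <= n < M)%N -> gamma n.+1 = tau t n.+1 / tau t n)
    (hratio : forall n, (1 <= n <= M)%N ->
      0 < gamma n.+1 /\ ((gamma n.+1)%:E <= gamma_starstar sigma)%E)
    (phi mu psi : nat -> 'rV[R]_d -> R) (r : nat -> R)
    (hphi : forall n, (n <= M)%N -> Hper a b 4 (phi n))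
    (hmu : forall n, (1 <= n < M)%N -> Hper a b 2 (mu n))
    (hmean : \int[dx a b]_x phi 1%N x = \int[dx a b]_x phi 0%N x)
    (hE1 : forall n, (1 <= n < M)%N ->
      C0 / 2 <= E1 a b eps S (phi n) + C0 <= 2 * C0)
    (hscheme : forall n, (1 <= n < M)%N ->
      scheme_step a b beta eps S C0 sigma t gamma phi mu r n)
    (hpsi : forall n, (1 <= n <= M)%N ->
      is_inv_neg_laplacian a b (phi n \- phi n.-1) (psi n)) :
  forall n, (1 <= n < M)%N ->
    Etilde a b beta S sigma t gamma phi psi r n.+1
      - Etilde a b beta S sigma t gamma phi psi r n <= 0.
Proof.
move=> n hn; have /andP[n1 nM] := hn.
have ht_lt k : (k < M)%N -> t k < t k.+1 by case: ht => _ _; exact.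
have ta'0 : 0 < tau t n.+1 by rewrite /tau subr_gt0 ht_lt.
have ta0 : 0 < tau t n.
  by rewrite /tau subr_gt0 -[in X in _ < X](prednK n1) ht_lt// prednK// ltnW.
have [g0 gle] : 0 < gamma n.+1 /\ ((gamma n.+1)%:E <= gamma_starstar sigma)%E.
  by apply: hratio; rewrite n1 ltnW.
have [g'0 g'le] : 0 < gamma n.+2 /\ ((gamma n.+2)%:E <= gamma_starstar sigma)%E.
  by apply: hratio.
have H0 : Hper a b 4 (phi n.-1) by apply: hphi; rewrite (leq_trans (leq_pred n))// ltnW.
have H1 : Hper a b 4 (phi n) by apply: hphi; exact: ltnW.
have H2 : Hper a b 4 (phi n.+1) by exact: hphi.
have L0 := Hper_L2 H0; have L1 := Hper_L2 H1; have L2p := Hper_L2 H2.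
have LD1 := L2B L0 L1; have LD2 := L2B L1 L2p.
have P1 : is_inv_neg_laplacian a b (phi n \- phi n.-1) (psi n).
  by apply: hpsi; rewrite n1 ltnW.
have P2 : is_inv_neg_laplacian a b (phi n.+1 \- phi n) (psi n.+1).
  exact: (hpsi n.+1).
have Lp2 : L2 a b (psi n.+1) by have [/Hper_L2] := P2.
have E0 : 0 < E1 a b eps S (phi n) + C0.
  by have /andP[+ _] := hE1 n hn; apply: lt_le_trans; rewrite divr_gt0.
have k0 : 0 <= 2 * sigma - 1 by have /andP[? _] := hsigma; lra.
have Lz := L2_0 a b.
have young := inv_neg_laplacian_young hab (Num.sqrt (gamma n.+1)) LD2 LD1 P2 P1.
have extra := G_young_le k0 g0 g'0 ta0 (hgamma n hn)
  (inv_neg_laplacian_ge0 hab LD2 P2) young (G_ge0 hsigma g0 gle g'0 g'le).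
have [F2lap _ _] := hscheme n hn.
have g1 : gamma n.+1 != -1 by rewrite gt_eqF// (lt_trans _ g0)// oppr_lt0.
have LF : L2 a b (F2 sigma t gamma phi n).
  by rewrite F2_incrementsE//; do 2 apply: L2_lin => //.
have test := inner_lap_inv_neg_laplacian hab LF (hmu n hn) LD2 F2lap P2.
have F2psi : inner a b (F2 sigma t gamma phi n) (psi n.+1) =
    (tau t n.+1)^-1 * ((1 + 2 * sigma * gamma n.+1) / (1 + gamma n.+1)
        * inner a b (psi n.+1) (phi n.+1 \- phi n)
      - (2 * sigma - 1) * gamma n.+1 ^+ 2 / (1 + gamma n.+1)
        * inner a b (psi n.+1) (phi n \- phi n.-1)).
  rewrite F2_incrementsE// innerC inner_linr//; last exact: L2_lin.
  by rewrite inner_linr// (innerC _ _ _ (cst 0)) inner0l; ring.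
rewrite -F2psi test in extra.
have muD := inner_scheme_mu ta'0 E0 L0 L1 L2p (Hper_L2 (hmu n hn)) (hscheme n hn).
have /andP[s1 _] := hsigma.
have UE : phi_sigma sigma phi n = lin sigma (phi n.+1 \- phi n) (phi n).
  by apply/funext => x; rewrite /phi_sigma /lin /=; ring.
have step := energy_step_le hab beta s1 hS H1 H2 UE.
rewrite muD in extra.
have r2 := sqr_ge0 (r n.+1 - r n).
rewrite /Etilde /Ebar /=; lra.
Qed.
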